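(* There exists an absolute constant $c>0$ such that, for every $n$, $A_n$ is normally an $n^{-cn^{1/3}}$-mixer.
   Context: $A_n$ is the alternating group on $n$ letters. The density of a subset $A\subseteq A_n$ is $\mu(A)=\frac{|A|}{|A_n|}$. A subset of $A_n$ is normal if it is closed under conjugation in $A_n$. $A_n$ is normally an $\epsilon$-mixer if for all normal sets $A,B,C\subseteq A_n$ of density $\ge\epsilon$, for $a\sim A$ and $b\sim B$ chosen independently and uniformly, the probability that $ab\in C$ is within a factor of $1.01$ of $\mu(C)$, i.e. $\mu(C)/1.01\le\Pr[ab\in C]\le1.01\,\mu(C)$. *)

(* Defs.v *)
From HB Require Import structures.
From mathcomp Require Import all_boot all_order all_algebra all_fingroup all_solvable.
From mathcomp Require Import reals exp.

Set Implicit Arguments.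
Unset Strict Implicit.
Unset Printing Implicit Defensive.

Import Order.TTheory GRing.Theory Num.Theory.

Local Open Scope ring_scope.

Definition uniform_pr (R : realType) (T : finType) (S : {set T}) (E : pred T) : R :=
  #|[set x in S | E x]|%:R / #|S|%:R.

Definition density (R : realType) (gT : finGroupType) (G A : {set gT}) : R :=
  #|A|%:R / #|G|%:R.

(* Independent uniform a ~ A and b ~ B amount to a uniform pair in A x B.
   [A <| G] is the library's relation on arbitrary sets: A is contained in G
   and stable under conjugation by G; A need not be a subgroup. *)
Definition normally_mixer (R : realType) (gT : finGroupType) (G : {group gT})
    (eps : R) : Prop :=
  forall A B C : {set gT},
    (A <| G)%g -> (B <| G)%g -> (C <| G)%g ->
    eps <= density R G A -> eps <= density R G B -> eps <= density R G C ->
    let p : R := uniform_pr R (setX A B) (fun ab => (ab.1 * ab.2)%g \in C) in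
    density R G C / (101 / 100) <= p /\ p <= (101 / 100) * density R G C.

(* Main.v *)
Require Import Defs.
From HB Require Import structures.
From mathcomp Require Import all_boot all_order all_algebra all_fingroup all_solvable.
From mathcomp Require Import all_field all_character.
From mathcomp Require Import reals exp.
From mathcomp Require Import zify ring lra.

Set Implicit Arguments.
Unset Strict Implicit.
Unset Printing Implicit Defensive.

Import Order.TTheory GRing.Theory Num.Theory GroupScope.
Local Open Scope ring_scope.

(** Write G = Alt_n. By the Frobenius formula the number N of pairs (a, b) in
    A x B with ab in C satisfies

      |G| N = sum_chi A(chi) B(chi) conj(C(chi)) / chi(1),

    where A(chi) is the sum of chi over A; the trivial character contributes
    |A||B||C|, and the task is to show that all the others contribute at most
    |A||B||C| / 200 in absolute value.

    The irreducible characters are sorted by their level: the least size d of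
    a set S of points whose pointwise stabiliser H in G has a nonzero fixed
    vector (for the character of a partition of n this is, essentially, n minus the
    longest row or column).
    Minimality of d says that averaging over the stabiliser of any smaller set
    kills the representation. Put k(g) = sum_(h in H) chi(g h). This function
    is bi-invariant under H, and the vanishing just described is a linear
    relation that expresses k(g) through values at permutations which move one
    point of S fewer out of S. So k(g) decays like (d / n) ^ j when g moves j
    points of S out of S (fixer_sum_decay). As chi(s) / chi(1) is an average of
    k(s ^ g) / k(1) over conjugates, it is bounded by a count of the d-sets I
    according to the number of points of s(I) outside I. If s has at most M
    cycles there are few d-sets that s almost preserves, and the outcome is
    |chi(s)| / chi(1) <= (32 M / n) ^ d for d <= M (irr_ratio_bound).

    Let w be n ^ (1/6) up to a constant factor, so that for small c sets of density
    at least n ^ (- c n ^ (1/3)) have density at least w ^ (- w ^ 2). All but a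
    negligible part of A consists of permutations with at most 16 w ^ 2 cycles
    (card_many_cycles). The levels are then treated in three ranges.
    - For 1 <= d <= w ^ 2 the degrees of the characters of level d add up to at
      most n ^ d (sum_degree_level), so with M = 16 w ^ 2 the contribution is at
      most of order n ^ (2 d) (32 M / n) ^ (3 d) = (2 ^ 27 w ^ 6 / n) ^ d. This
      is where the exponent 1/3 comes from.
    - For w ^ 2 < d <= w ^ 4 the same bound with M = w ^ 4 makes every
      character ratio so small that the Parseval identity for B and C is
      enough.
    - For d > w ^ 4 the degree is at least 2 ^ (3 w ^ 3) (irr_degree_fixer): each
      time three more points are fixed the representation splits, because a
      3-cycle on these points commutes with the smaller group and would
      otherwise act as a scalar. Parseval then concludes as before.

    For the finitely many small n the constant c is taken so small that only
    the whole group is dense enough. *)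

(** * Averaging a character over a subgroup *)

(** A rank factorisation A = C B of an idempotent has B C = 1, whence tr A = tr (B C)
    is the rank; X |-> B X C restricts operators to the image of A. *)
Lemma idempotent_factor (F : fieldType) n (A : 'M[F]_n) : A *m A = A ->
  exists r, exists (C : 'M_(n, r)) (B : 'M_(r, n)),
    [/\ C *m B = A, B *m C = 1%:M & \tr A = r%:R].
Proof.
move=> AA; exists (\rank A), (col_base A), (row_base A).
have CB := mulmx_base A.
suff BC : row_base A *m col_base A = 1%:M.
  by split=> //; rewrite -{1}CB mxtrace_mulC BC mxtrace1.
apply: (row_free_inj (row_base_free A)); apply: (row_full_inj (col_base_full A)).
by rewrite mul1mx mulmxA mulmxA CB -mulmxA CB AA.
Qed.

Section SubgroupSums.
Variables (gT : finGroupType) (G H : {group gT}).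
Hypothesis sHG : H \subset G.

Section Rep.
Variables (n : nat) (rG : mx_representation algC G n).
Definition subgroup_mean : 'M[algC]_n := #|H|%:R^-1 *: \sum_(h in H) rG h.
Let P := subgroup_mean.

Lemma rep_mulr_mean h : h \in H -> rG h *m P = P.
Proof.
move=> Hh; rewrite -scalemxAr mulmx_sumr; congr (_ *: _).
rewrite [RHS](reindex_inj (mulgI h)) /=; apply: eq_big => g; first by rewrite groupMl.
by move=> Hg; rewrite repr_mxM // (subsetP sHG).
Qed.

Lemma mean_idem : P *m P = P.
Proof.
rewrite {1}/P/subgroup_mean -scalemxAl mulmx_suml (eq_bigr (fun=> P)).
  by rewrite sumr_const -scaler_nat scalerA mulVf ?scale1r ?neq0CG.
exact: rep_mulr_mean.
Qed.

Lemma trace_mean g : g \in G ->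
  \tr (rG g *m P) = #|H|%:R^-1 * \sum_(h in H) cfRepr rG (g * h)%g.
Proof.
move=> Gg; rewrite -scalemxAr mulmx_sumr mxtraceZ raddf_sum /=; congr (_ * _).
apply: eq_bigr => h Hh; have Gh := subsetP sHG h Hh.
by rewrite cfunE groupM // mulr1n repr_mxM.
Qed.
End Rep.

Lemma char_sum_ge0 (chi : 'CF(G)) : chi \is a character ->
  0 <= \sum_(h in H) chi h.
Proof.
move=> /char_reprP[[n rG] ->].
have := trace_mean rG (group1 G); rewrite repr_mx1 mul1mx.
have [r [C [B [_ _ ->]]]] := idempotent_factor (mean_idem rG).
move/(congr1 (GRing.mul #|H|%:R)); rewrite mulVKf ?neq0CG //.
by under eq_bigr do rewrite mul1g; move<-; rewrite mulr_ge0 ?ler0n.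
Qed.

(** The mean over H is a projection; its trace is its rank, so it vanishes as
    soon as its trace does. *)
Lemma char_sum_translate0 (chi : 'CF(G)) g : chi \is a character -> g \in G ->
  \sum_(h in H) chi h = 0 -> \sum_(h in H) chi (g * h)%g = 0.
Proof.
move=> /char_reprP[[n rG] ->] Gg s0.
have := trace_mean rG (group1 G); rewrite repr_mx1 mul1mx.
under eq_bigr do rewrite mul1g.
rewrite s0 mulr0; have [r [C [B [CB _ ->]]]] := idempotent_factor (mean_idem rG).
move/eqP; rewrite pnatr_eq0 => /eqP r0.
have P0 : subgroup_mean rG = 0 by move: C B CB; rewrite r0 => C B <-; rewrite thinmx0 mul0mx.
have := trace_mean rG Gg; rewrite P0 mulmx0 mxtrace0 => /esym/eqP.
by rewrite mulf_eq0 invr_eq0 (negPf (neq0CG _)) => /eqP.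
Qed.

(** The normaliser of H acts on the H-fixed vectors, with character
    g |-> |H|^-1 * sum_(h in H) chi (g * h); a character is bounded by its degree. *)
Lemma char_sum_translate_norm (chi : 'CF(G)) g :
  chi \is a character -> g \in 'N_G(H)%g ->
  `|\sum_(h in H) chi (g * h)%g| <= \sum_(h in H) chi h.
Proof.
move=> /char_reprP[[n rG] ->] Ng; have /setIP[Gg nHg] := Ng.
have sNG := subsetIl G 'N(H)%g.
set P := subgroup_mean rG; have PP : P *m P = P by apply: mean_idem.
have [r [C [B [CB BC trP]]]] := idempotent_factor PP.
have BP : B *m P = B by rewrite -CB mulmxA BC mul1mx.
have comP x : x \in 'N_G(H)%g -> rG x *m P = P *m rG x.
  case/setIP=> Gx nHx; rewrite -scalemxAr -scalemxAl mulmx_sumr mulmx_suml; congr (_ *: _).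
  rewrite [LHS](reindex_inj (conjg_inj x)) /=.
  apply: eq_big => h; first by rewrite memJ_norm.
  rewrite memJ_norm // => Hh; have Gh := subsetP sHG h Hh.
  by rewrite -!repr_mxM ?groupJ // -conjgC.
(* The representation of the normaliser on the fixed space, in the basis given by B. *)
have rmx : mx_repr 'N_G(H)%g (fun x => B *m rG x *m C).
  split=> [|x y Nx Ny]; first by rewrite repr_mx1 mulmx1.
  rewrite repr_mxM ?(subsetP sNG) // !mulmxA -(mulmxA (B *m rG x) C B) CB.
  by rewrite -(mulmxA B (rG x) P) comP // (mulmxA B P) BP.
pose rN := MxRepresentation rmx.
have /char1_ge_norm := cfRepr_char rN => /(_ g).
rewrite cfRepr1 cfunE Ng mulr1n /= -(mulmxA B) mxtrace_mulC -mulmxA CB trace_mean //.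
have := trace_mean rG (group1 G); rewrite repr_mx1 mul1mx -/P trP => ->.
rewrite normrM ger0_norm ?invr_ge0 ?ler0n // ler_pM2l ?invr_gt0 ?gt0CG //.
by under [in X in _ <= X -> _]eq_bigr do rewrite mul1g.
Qed.
End SubgroupSums.

(** * Class sums and the Frobenius formula *)

Section ClassSums.
Variables (gT : finGroupType) (G : {group gT}).

(** The sum of the conjugates of x is central, hence acts as a scalar (Schur). *)
Lemma irr_class_average (i : Iirr G) x h : x \in G -> h \in G ->
  \sum_(g in G) 'chi_i (x ^ g * h)%g = #|G|%:R * ('chi_i x * 'chi_i h / 'chi_i 1%g).
Proof.
move=> Gx Gh; set rG := 'Chi_i.
have absG : mx_absolutely_irreducible rG.
  by apply/groupC/socle_irr.
pose S := \sum_(g in G) rG (x ^ g)%g.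
have cS : centgmx rG S.
  suff cSy y : y \in G -> rG y *m S = S *m rG y by apply/centgmxP=> y /cSy.
  move=> Gy; rewrite mulmx_sumr mulmx_suml [LHS](reindex_inj (mulIg y)) /=.
  apply: eq_big => [g|g]; rewrite groupMr // => Gg.
  by rewrite -!repr_mxM ?groupJ ?groupM // conjgM -conjgC.
have /is_scalar_mxP[s Ss] := mx_abs_irr_cent_scalar absG cS.
have n0 : 'chi_i 1%g != 0 by apply: irr1_neq0.
have sE : s * 'chi_i 1%g = #|G|%:R * 'chi_i x.
  rewrite -irrRepr cfRepr1 mulr_natr -mxtrace_scalar -Ss raddf_sum /=.
  rewrite mulr_natl -sumr_const; apply: eq_bigr => g Gg.
  by rewrite -(cfunJ _ _ Gg) cfunE groupJ.
transitivity (\tr (S *m rG h)).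
  rewrite mulmx_suml raddf_sum; apply: eq_bigr => g Gg /=.
  by rewrite -irrRepr cfunE groupM ?groupJ // repr_mxM ?groupJ.
rewrite Ss mul_scalar_mx mxtraceZ.
have -> : \tr (rG h) = 'chi_i h by rewrite -irrRepr cfunE Gh.
by rewrite !mulrA -sE mulrAC mulfK.
Qed.
End ClassSums.

Section NormalSets.
Variables (gT : finGroupType) (G : {group gT}).
Implicit Types A B C : {set gT}.

Lemma irr_normal_sum (i : Iirr G) A h : A <| G -> h \in G ->
  \sum_(a in A) 'chi_i (a * h)%g = (\sum_(a in A) 'chi_i a) * 'chi_i h / 'chi_i 1%g.
Proof.
move=> /andP[sAG nAG] Gh; apply: (mulfI (neq0CG G)).
transitivity (\sum_(a in A) \sum_(g in G) 'chi_i (a ^ g * h)%g); last first.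
  rewrite !mulr_suml mulr_sumr; apply: eq_bigr => a Aa.
  by rewrite irr_class_average ?(subsetP sAG a).
rewrite exchange_big mulr_natl -sumr_const; apply: eq_bigr => g Gg.
rewrite [LHS](reindex_inj (conjg_inj g)) /=; apply: eq_bigl => a.
by rewrite memJ_norm // (subsetP nAG).
Qed.

Definition product_count A B C :=
  #|[set ab in setX A B | (ab.1 * ab.2)%g \in C]|.

(** Frobenius' formula: detect a * b = c with the regular character, then pull
    the normal sets A and B out one at a time. *)
Lemma product_count_irr A B C : A <| G -> B <| G -> C <| G ->
  #|G|%:R * (product_count A B C)%:R =
  \sum_(i : Iirr G) (\sum_(a in A) 'chi_i a) * (\sum_(b in B) 'chi_i b) *
     (\sum_(c in C) 'chi_i c)^* / 'chi_i 1%g.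
Proof.
move=> nA nB nC; have sAG := normal_sub nA; have sBG := normal_sub nB; have sCG := normal_sub nC.
transitivity (\sum_(c in C) \sum_(b in B) \sum_(a in A)
                 cfReg G (a * (b * c^-1))%g).
  rewrite (exchange_big_dep (mem B)) //=.
  under eq_bigr => b Bb do rewrite (exchange_big_dep (mem A)) //=.
  rewrite exchange_big /product_count -sum1_card natr_sum mulr_sumr.
  rewrite pair_big_dep /= big_mkcond [RHS]big_mkcond; apply: eq_bigr => -[a b] _ /=.
  rewrite !inE /=; case: ifP => [/andP[/andP[-> ->] Cab]|nabC] /=.
    rewrite (bigD1 (a * b)%g) ?Cab //= cfRegE mulgA mulgV eqxx mulr1n mulr1.
    rewrite big1 ?addr0 // => c /andP[_ nc].
    by rewrite cfRegE mulgA -eq_mulgV1 eq_sym (negPf nc).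
  case: ifP => // AB; rewrite big1 // => c /andP[/andP[Cc _] _].
  rewrite cfRegE mulgA -eq_mulgV1.
  by case: eqP => // abc; rewrite AB abc Cc in nabC.
under eq_bigr => c Cc do under eq_bigr => b Bb do
  under eq_bigr => a Aa do rewrite cfReg_sum sum_cfunE.
under eq_bigr => c Cc do under eq_bigr => b Bb do rewrite exchange_big /=.
under eq_bigr => c Cc do rewrite exchange_big /=.
rewrite exchange_big /=; apply: eq_bigr => i _.
have X0 := irr1_neq0 i.
transitivity (\sum_(c in C) \sum_(b in B) (\sum_(a in A) 'chi_i a) * 'chi_i (b * c^-1)%g).
  apply: eq_bigr => c Cc; apply: eq_bigr => b Bb.
  under eq_bigr do rewrite cfunE.
  rewrite -mulr_sumr irr_normal_sum //; first by rewrite mulrC divfK.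
  by rewrite groupM ?groupV ?(subsetP sBG b) ?(subsetP sCG c).
set SA := \sum_(a in A) _; rewrite rmorph_sum /= -mulrA; set SB := \sum_(b in B) _.
rewrite [X in _ = _ * X]mulr_suml mulr_sumr; apply: eq_bigr => c Cc.
by rewrite -mulr_sumr irr_normal_sum ?groupV ?(subsetP sCG c) // irr_inv -!mulrA.
Qed.

(** Parseval for the indicator function of A. *)
Lemma sum_irr_normal_sum_norm A : A <| G ->
  \sum_(i : Iirr G) `|\sum_(a in A) 'chi_i a| ^+ 2 = #|G|%:R * #|A|%:R.
Proof.
move=> nA; have sAG := normal_sub nA.
have: '['1_A : 'CF(G)] = #|A|%:R / #|G|%:R by rewrite cfdot_cfuni // setIid.
rewrite cfdot_sum_irr => /(congr1 (fun x => #|G|%:R ^+ 2 * x)).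
rewrite mulrA [X in X / _]mulrAC expr2 mulfK ?neq0CG // => <-; rewrite mulr_sumr.
apply: eq_bigr => i _; rewrite -normCK.
have ->: \sum_(a in A) 'chi_i a = #|G|%:R * ('['1_A, 'chi_i])^*.
  rewrite cfdotE rmorphM /= fmorphV rmorph_nat mulVKf ?neq0CG // rmorph_sum /=.
  rewrite big_mkcond [RHS]big_mkcond; apply: eq_bigr => x _.
  rewrite cfuniE //; case: (boolP (x \in A)) => [Ax|_]; last by rewrite mul0r rmorph0 if_same.
  by rewrite (subsetP sAG) // mul1r conjCK.
by rewrite normrM norm_conjC normr_nat exprMn.
Qed.
End NormalSets.

(** * Pointwise stabilisers in the alternating group *)

Section Fixer.
Variable T : finType.
Implicit Types (S W : {set T}) (s t g h : {perm T}).

Definition fixer S : {group {perm T}} := 'C_('Alt_T)(S | 'P)%G.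

Lemma fixerP S g :
  reflect (g \in 'Alt_T /\ {in S, forall x, g x = x}) (g \in fixer S).
Proof.
apply: (iffP setIP) => -[Ag Sg]; split=> //; first by move/astabP: Sg => Sg x /Sg.
by apply/astabP=> x /Sg.
Qed.

Lemma fixer_sub_Alt S : fixer S \subset 'Alt_T.
Proof. exact: subsetIl. Qed.

Lemma fixerS S1 S2 : S1 \subset S2 -> fixer S2 \subset fixer S1.
Proof.
move=> /subsetP sS; apply/subsetP=> g /fixerP[Ag g1]; apply/fixerP; split=> // x Sx.
exact/g1/sS.
Qed.

(** A third free point z makes the transposition of i and w even. *)
Lemma exists_fixer_map S i w : i \notin S -> w \notin S -> (#|S| + 3 <= #|T|)%N ->
  exists2 c, c \in fixer S & c i = w.
Proof.
move=> iS wS ltS; have [<-|neq_iw] := eqVneq i w.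
  by exists 1%g; rewrite ?group1 ?perm1.
have /subsetPn[z _] : ~~ (setT \subset S :|: [set i; w]).
  apply: contraL ltS => /subset_leq_card; rewrite cardsT -ltnNge => leT.
  by have := (leq_card_setU S [set i; w]).1; rewrite cards2 neq_iw; lia.
rewrite !inE !negb_or => /and3P[zS zi zw].
exists (tperm i w * tperm i z)%g; last by rewrite permM tpermL tpermD // eq_sym.
apply/fixerP; split.
  by rewrite Alt_even odd_permM !odd_tperm neq_iw eq_sym zi.
move=> x Sx; have nx y : y \notin S -> y != x by apply: contraNneq => ->.
by rewrite permM (tpermD (nx i iS) (nx w wS)) (tpermD (nx i iS) (nx z zS)).
Qed.

Lemma card_fixer_move S i W : i \notin S -> [disjoint W & S] -> (#|S| + 3 <= #|T|)%N ->
  #|[set h in fixer S | h i \in W]| = (#|W| * #|fixer (i |: S)|)%N.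
Proof.
move=> iS dWS ltS.
rewrite -sum1_card (partition_big (fun h : {perm T} => h i) (mem W)) /=; last first.
  by move=> h; rewrite inE => /andP[].
rewrite -sum_nat_const; apply: eq_bigr => w Ww.
have wS : w \notin S by rewrite (disjointFr dWS).
have [c /fixerP[Ac cS] ci] := exists_fixer_map iS wS ltS.
rewrite sum1_card -[RHS](card_imset _ (mulIg c)); apply: eq_card => h.
apply/idP/imsetP; last first.
  case=> h' /fixerP[Ah' h'S] ->.
  rewrite unfold_in /= inE permM h'S ?setU11 // ci Ww eqxx !andbT.
  apply/fixerP; split=> [|x Sx]; first by rewrite groupM.
  by rewrite permM h'S ?cS // inE Sx orbT.
  rewrite unfold_in /= inE.
  case/andP=> /andP[/fixerP[Ah hS] _] /eqP hi; exists (h * c^-1)%g; last by rewrite mulgKV.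
  apply/fixerP; split=> [|x]; first by rewrite groupM ?groupV.
  rewrite permM !inE => /orP[/eqP->|Sx]; first by rewrite hi -ci permK.
  by rewrite hS // -{1}(cS _ Sx) permK.
Qed.

(** * Decay of characters averaged over a stabiliser *)

Definition escape S t := #|t @: S :\: S|.

Lemma cfun_mulC (chi : 'CF('Alt_T)) x y : x \in 'Alt_T -> y \in 'Alt_T ->
  chi (x * y)%g = chi (y * x)%g.
Proof. by move=> Ax Ay; rewrite -(cfunJ chi (y * x) Ay) conjgE !mulgA mulVg mul1g. Qed.

Definition fixer_sum (chi : 'CF('Alt_T)) S t := \sum_(h in fixer S) chi (t * h)%g.

Lemma fixer_sumM chi S b t a : b \in fixer S -> a \in fixer S -> t \in 'Alt_T ->
  fixer_sum chi S (b * t * a)%g = fixer_sum chi S t.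
Proof.
move=> Sb Sa At; rewrite /fixer_sum (reindex_inj (mulgI a^-1%g)) /=.
rewrite (reindex_inj (mulIg b^-1%g)) /=.
have [Aa Ab] := (subsetP (fixer_sub_Alt S) a Sa, subsetP (fixer_sub_Alt S) b Sb).
apply: eq_big => h; first by rewrite groupMl ?groupV // groupMr ?groupV.
rewrite groupMl ?groupV // groupMr ?groupV // => Sh.
have Ah := subsetP (fixer_sub_Alt S) h Sh.
rewrite !mulgA mulgK -!mulgA cfun_mulC ?groupM ?groupV //.
by rewrite mulgA mulgKV.
Qed.

(** The sum is bi-invariant under the stabiliser of S, so it does not depend on
    which point outside S is the image of i. *)
Lemma fixer_sum_agree chi S i t t' : t \in 'Alt_T -> t' \in 'Alt_T -> i \in S ->
    (2 * #|S| + 2 <= #|T|)%N -> {in S :\ i, t =1 t'} -> t i \notin S -> t' i \notin S ->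
  fixer_sum chi S t = fixer_sum chi S t'.
Proof.
move=> At At' Si ltS tt' tiS t'iS.
pose U := S :|: t @: (S :\ i).
have notU s : {in S :\ i, t =1 s} -> s i \notin S -> s i \notin U.
  move=> ts siS; rewrite inE negb_or siS; apply/imsetP => -[x].
  by move=> Sx; rewrite ts // => /perm_inj ix; rewrite ix !inE eqxx in Sx.
have ltU : (#|U| + 3 <= #|T|)%N.
  have := (leq_card_setU S (t @: (S :\ i))).1; rewrite -/U.
  rewrite (card_imset _ (@perm_inj _ t)).
  by move: (cardsD1 i S); rewrite Si; lia.
have [a /fixerP[Aa aU] ati] := exists_fixer_map (notU t (fun _ _ => erefl) tiS) (notU t' tt' t'iS) ltU.
have Sa : a \in fixer S by apply/fixerP; split=> // x Sx; apply: aU; rewrite inE Sx.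
suff Sb : (t' * (t * a)^-1)%g \in fixer S.
  by rewrite -(fixer_sumM chi Sb Sa At) -mulgA mulgKV.
apply/fixerP; split=> [|x Sx]; first by rewrite groupM ?groupV ?groupM.
rewrite permM; apply: (canLR (permK _)); rewrite permM.
have [->|xi] := eqVneq x i; first by rewrite ati.
have Six : x \in S :\ i by rewrite !inE xi.
by rewrite aU ?tt' // inE -tt' // imset_f ?orbT.
Qed.

(** The linear relation behind the decay: letting the image of the single point i
    vary over all available points gives total sum 0. *)
Lemma fixer_sum_move0 (chi : 'CF('Alt_T)) S i t : chi \is a character -> t \in 'Alt_T ->
    \sum_(h in fixer (S :\ i)) chi h = 0 ->
  \sum_(h in fixer (S :\ i)) fixer_sum chi S (h * t)%g = 0.
Proof.
move=> Nchi At chi0; rewrite exchange_big big1 //= => h' Sh'.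
have Ah' := subsetP (fixer_sub_Alt S) _ Sh'.
apply: etrans (char_sum_translate0 (fixer_sub_Alt _) Nchi (groupM At Ah') chi0).
apply: eq_bigr => h /(subsetP (fixer_sub_Alt _)) Ah.
by rewrite -mulgA cfun_mulC ?groupM.
Qed.

(** In the relation of the previous lemma the image of i lies outside S for at
    least n - 2 |S| choices, which all give the same value, and inside S for
    only escape S t choices, which have one escaping point fewer. *)
Lemma fixer_sum_step chi S i t : chi \is a character -> t \in 'Alt_T -> i \in S ->
    (2 * #|S| + 2 <= #|T|)%N -> t i \notin S ->
    \sum_(h in fixer (S :\ i)) chi h = 0 ->
  forall B : algC,
    (forall t', t' \in 'Alt_T -> escape S t' = (escape S t).-1 -> `|fixer_sum chi S t'| <= B) ->
  `|fixer_sum chi S t| * (#|T| - 2 * #|S|)%:R <= (escape S t)%:R * B.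
Proof.
move=> Nchi At Si ltS tiS chi0 B leB.
set S' := S :\ i; set A' := S :\: t @: S'.
have tS : t @: S = t i |: t @: S' by rewrite -imsetU1 setD1K.
have cS : #|S| = #|S'|.+1 by rewrite (cardsD1 i S) Si.
have tiS' : t i \notin t @: S'.
  by apply/imsetP=> -[x]; rewrite !inE => /andP[xi _] /perm_inj ix; rewrite ix eqxx in xi.
have esc : escape S t = #|A'|.
  have e1 : (escape S t + #|S :&: t @: S'| = #|S|)%N.
    rewrite -(card_imset S (@perm_inj _ t)) -(cardsID S (t @: S)) addnC; congr (_ + _)%N.
    apply: eq_card => x; rewrite tS !inE; have [->|] := eqVneq x (t i); first by rewrite (negPf tiS) andbF.
    by rewrite andbC.
  by have := cardsID (t @: S') S; rewrite -/A'; lia.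
(* The values of h i that t sends into S (W2), resp. outside S (W1). *)
pose W2 := t^-1%g @: A'; pose W1 := ~: S' :\: W2.
have inW2 x : (x \in W2) = (t x \in A').
  by rewrite /W2 im_permV inE.
have iS' : i \notin S' by rewrite !inE eqxx.
have d1 : [disjoint W1 & S'].
  by rewrite disjoints_subset subsetDl.
have d2 : [disjoint W2 & S'].
  rewrite disjoints_subset; apply/subsetP=> x; rewrite inW2 inE => /andP[+ _].
  by rewrite in_setC; apply: contra => S'x; apply: imset_f.
have ltS' : (#|S'| + 3 <= #|T|)%N by rewrite cS in ltS; lia.
have := card_fixer_move iS' d1 ltS'; have := card_fixer_move iS' d2 ltS'.
rewrite setD1K //; set X2 := [set h in _ | _ \in W2]; set Y1 := [set h in _ | _ \in W1] => cX2 cY1.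
have cW2 : #|W2| = escape S t by rewrite card_imset ?esc //; apply: perm_inj.
have cW1 : (#|T| - 2 * #|S| <= #|W1|)%N.
  have : (#|~: S'| <= #|W1| + #|W2|)%N.
    by rewrite -(cardsID W2 (~: S')) addnC leq_add2l subset_leq_card ?subsetIr.
  by have := cardsC S'; have : (#|A'| <= #|S|)%N := subset_leq_card (subsetDl _ _); lia.
have sum0 := fixer_sum_move0 Nchi At chi0.
have split0 : \sum_(h in Y1) fixer_sum chi S (h * t)%g = - \sum_(h in X2) fixer_sum chi S (h * t)%g.
  apply/eqP; rewrite -addr_eq0; apply/eqP; rewrite -[RHS]sum0 [RHS](bigID (fun h : {perm T} => h i \in W2)) /= addrC.
  congr (_ + _); apply: eq_bigl => h; rewrite [LHS]inE //.
  apply: andb_id2l => /fixerP[Ah hS']; rewrite in_setD in_setC.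
  case: (h i \in W2) => //=; apply: contraNN iS' => S'hi.
  by have /perm_inj <- := hS' _ S'hi.
have Y1E : \sum_(h in Y1) fixer_sum chi S (h * t)%g = fixer_sum chi S t *+ #|Y1|.
  rewrite -sumr_const; apply: eq_bigr => h; rewrite inE => /andP[/fixerP[Ah hS'] W1hi].
  apply: (fixer_sum_agree _ _ _ Si) => //; first by rewrite groupM.
    by move=> x S'x; rewrite permM hS'.
  rewrite permM; move: W1hi; rewrite inE inW2 => /andP[A'thi hiS']; apply: contra A'thi => Sthi.
  rewrite inE Sthi andbT; apply/imsetP=> -[x S'x] /perm_inj hix.
  by rewrite inE hix S'x in hiS'.
have X2B : `|\sum_(h in X2) fixer_sum chi S (h * t)%g| <= B *+ #|X2|.
  rewrite -sumr_const (le_trans (ler_norm_sum _ _ _)) // ler_sum // => h.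
  rewrite inE inW2 => /andP[/fixerP[Ah hS']]; rewrite inE => /andP[thi Sthi].
  apply: leB; first by rewrite groupM.
  rewrite /escape (cardsD1 (t i) (t @: S :\: S)) !inE tiS imset_f //=.
  apply: eq_card => x; rewrite -{1}[S](setD1K Si) imsetU1 permM tS !inE.
  have -> : (h * t)%g @: S' = t @: S'.
    by apply: eq_in_imset => y S'y; rewrite permM hS'.
  have [->|nx] := eqVneq x (t (h i)); first by rewrite Sthi !andbF.
  have [->|nx'] := eqVneq x (t i); first by rewrite (negPf tiS') andbF.
  by [].
have H0 : (0 < #|fixer S|)%N by apply: cardG_gt0.
rewrite Y1E in split0; have := X2B; rewrite -normrN -split0 normrMn.
rewrite -[_ *+ #|Y1|]mulr_natr -[B *+ _]mulr_natr cX2 cY1 cW2 !natrM !mulrA.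
rewrite ler_pM2r ?ltr0n // [B * _]mulrC.
by apply: le_trans; rewrite ler_wpM2l // ler_nat.
Qed.

Lemma fixer_sum_decay chi S t : chi \is a character -> t \in 'Alt_T ->
    (2 * #|S| + 2 <= #|T|)%N ->
    {in S, forall i, \sum_(h in fixer (S :\ i)) chi h = 0} ->
  `|fixer_sum chi S t| * (#|T| - 2 * #|S|)%:R ^+ escape S t
    <= (escape S t)`!%:R * fixer_sum chi S 1.
Proof.
move=> Nchi + ltS chi0; move: {2}(escape S t) (erefl (escape S t)) => j.
elim: j t => [|j IHj] t /[dup] et -> At.
  rewrite expr0 mulr1 fact0 mul1r /fixer_sum.
  under [in X in _ <= X]eq_bigr do rewrite mul1g.
  apply: (char_sum_translate_norm (fixer_sub_Alt S) Nchi).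
  have tS : t @: S = S.
    apply/eqP; rewrite eqEcard (card_imset _ (@perm_inj _ t)) leqnn andbT.
    by rewrite -setD_eq0 -cards_eq0 -/(escape S t) et.
  rewrite inE At inE; apply/subsetP=> _ /imsetP[h /fixerP[Ah hS] ->].
  apply/fixerP; split=> [|x]; first by rewrite groupJ.
  by rewrite -{1}tS => /imsetP[y Sy ->]; rewrite permJ hS.
have [i Si tiS] : exists2 i, i \in S & t i \notin S.
  have: (0 < escape S t)%N by rewrite et.
  by case/card_gt0P=> x; rewrite inE => /andP[xS /imsetP[i Si xE]]; exists i; rewrite -?xE.
have n2 : (0 < (#|T| - 2 * #|S|)%:R :> algC) by rewrite ltr0n; lia.
set N := (_ - _)%N in n2 *.
have := fixer_sum_step Nchi At Si ltS tiS (chi0 i Si) (B := j`!%:R * fixer_sum chi S 1 / N%:R ^+ j).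
rewrite et => /(_ _) le1.
rewrite exprS mulrA factS natrM -ler_pdivlMr ?exprn_gt0 //.
apply: le_trans (le1 _) _; last by rewrite !(@mulrA algC).
move=> t' At' /= ej; rewrite ler_pdivlMr ?exprn_gt0 //.
by have := IHj t' ej At'; rewrite ej.
Qed.
End Fixer.

(** * Counting sets by their number of escaping points *)

Section EscapeCount.
Variables (T : finType) (s : {perm T}).
Implicit Types I : {set T}.
Local Notation n := #|T|.
Local Notation m := #|porbits s|.

Definition escape_sets d j := [set I : {set T} | (#|I| == d) && (escape I s == j)].

(** Along the cycles of s the set I is a union of whole cycles and of arcs; these
    are the first points of the arcs. *)
Definition starts I := I :\: s @: I.

Lemma card_starts I : #|starts I| = escape I s.
Proof.
have c := card_imset I (@perm_inj _ s).
by have := cardsID (s @: I) I; have := cardsID I (s @: I); rewrite setIC /escape /starts; lia.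
Qed.

Lemma escape_le I : (escape I s <= #|I|)%N.
Proof. by rewrite -card_starts subset_leq_card ?subsetDl. Qed.

(** Double counting of pairs (I, x) with x the start of an arc of I. Deleting x
    either removes a one-point arc, in which case x is arbitrary, or shortens an
    arc, and then s x is a start of the smaller set. *)
Lemma escape_sets_rec d j :
  (j.+1 * #|escape_sets d.+1 j.+1| <=
     j.+1 * #|escape_sets d j.+1| + n * #|escape_sets d j|)%N.
Proof.
pose E d j := [set Ix : {set T} * T | (Ix.1 \in escape_sets d j) && (Ix.2 \in starts Ix.1)].
have cE d' j' : #|E d' j'| = (j' * #|escape_sets d' j'|)%N.
  rewrite -sum1_card (eq_bigl (fun Ix => (Ix.1 \in escape_sets d' j') && (Ix.2 \in starts Ix.1))).
    rewrite -(pair_big_dep (mem (escape_sets d' j')) (fun I x => x \in starts I) (fun _ _ => 1%N)) /=.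
    rewrite mulnC -sum_nat_const; apply: eq_bigr => I; rewrite inE => /andP[_ /eqP].
    by rewrite -card_starts sum1_card.
  by move=> Ix; rewrite inE.
rewrite -!cE; pose F := [set Ix : {set T} * T | Ix.1 \in escape_sets d j].
have -> : (n * #|escape_sets d j| = #|F|)%N.
  rewrite -cardsT mulnC -cardsX; apply: eq_card => Ix; by rewrite !inE andbT.
have step (Ix : {set T} * T) : Ix \in E d.+1 j.+1 ->
  [/\ Ix.2 \in Ix.1, #|Ix.1 :\ Ix.2| = d, s Ix.2 != Ix.2 &
      starts (Ix.1 :\ Ix.2) = if s Ix.2 \in Ix.1 then s Ix.2 |: (starts Ix.1 :\ Ix.2)
                             else starts Ix.1 :\ Ix.2].
  case: Ix => I x; rewrite !inE /= => /andP[/andP[/eqP cI _] /andP[xsI Ix]].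
  have sx : s x != x.
    by apply: contraNneq xsI => sxx; rewrite -{1}sxx; apply: imset_f.
  split=> //; first by rewrite (cardsD1 x) Ix in cI; case: cI.
  have sD : s @: (I :\ x) = (s @: I) :\ s x.
    rewrite -{2}(setD1K Ix) imsetU1 setU1K //.
    by apply/imsetP=> -[y]; rewrite !inE => /andP[yx _] /perm_inj xy; rewrite xy eqxx in yx.
  rewrite /starts sD; apply/setP=> y; case: ifP => Isx; rewrite !inE.
    have [->|ny] := eqVneq y (s x); first by rewrite /= Isx sx.
    by rewrite /= andbCA.
  have [->|ny] := eqVneq y (s x); first by rewrite /= Isx !andbF.
  by rewrite /= andbCA.
pose up := [set Ix : {set T} * T | s Ix.2 \in Ix.1].
rewrite -(cardsID up) leq_add //.
  pose f (Ix : {set T} * T) := (Ix.1 :\ Ix.2, s Ix.2).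
  rewrite -(card_in_imset (f := f)); last first.
    move=> [I x] [J y] /setIP[/step[/= Ix _ _ _] _] /setIP[/step[/= Jy _ _ _] _] [eIJ /perm_inj exy].
    by rewrite -(setD1K Ix) -(setD1K Jy) eIJ exy.
  apply/subset_leq_card/subsetP=> _ /imsetP[[I x] /setIP[EIx Isx] ->].
  rewrite inE /= in Isx; have [/= Ix cI sx st] := step _ EIx.
  move: EIx; rewrite inE /= => /andP[]; rewrite inE -card_starts => /andP[_ /eqP esc] /= stx.
  have nsx : s x \notin starts I :\ x by rewrite /starts !inE imset_f //= andbF.
  rewrite inE /=; apply/andP; split; last by rewrite st Isx setU11.
  by rewrite inE cI eqxx -card_starts st Isx cardsU1 nsx -esc (cardsD1 x (starts I)) stx eqxx.
pose f (Ix : {set T} * T) := (Ix.1 :\ Ix.2, Ix.2).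
rewrite -(card_in_imset (f := f)); last first.
  move=> [I x] [J y] /setDP[/step[/= Ix _ _ _] _] /setDP[/step[/= Jy _ _ _] _] [eIJ exy].
  by rewrite -(setD1K Ix) -(setD1K Jy) eIJ exy.
apply/subset_leq_card/subsetP=> _ /imsetP[[I x] /setDP[EIx Isx] ->].
rewrite inE /= in Isx; have [/= Ix cI sx st] := step _ EIx.
move: EIx; rewrite inE /= => /andP[]; rewrite inE -card_starts => /andP[_ /eqP esc] /= stx.
rewrite !inE /= cI eqxx -card_starts st (negPf Isx).
by rewrite andTb; move: esc; rewrite (cardsD1 x (starts I)) stx add1n => /eqP; rewrite eqSS.
Qed.

Lemma escape_sets0 d j : (d < j)%N -> #|escape_sets d j| = 0%N.
Proof.
move=> ltdj; apply/eqP; rewrite cards_eq0 -subset0; apply/subsetP=> I.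
by rewrite !inE => /andP[/eqP cI /eqP eI]; have := escape_le I; rewrite cI eI leqNgt ltdj.
Qed.

Definition few_subsets f := (\sum_(i < f.+1) 'C(m, i))%N.

Lemma few_subsetsS f : (few_subsets f <= few_subsets f.+1)%N.
Proof. by rewrite /few_subsets [X in (_ <= X)%N]big_ord_recr leq_addr. Qed.

Lemma card_few_subsets f (X : {set {set T}}) : #|X| = m ->
  #|[set P : {set {set T}} | (P \subset X) && (#|P| <= f)%N]| = few_subsets f.
Proof.
rewrite /few_subsets => <-; rewrite -sum1_card.
rewrite (partition_big (fun P : {set {set T}} => inord #|P| : 'I_f.+1) xpredT) //=.
apply: eq_bigr => i _; rewrite -cards_draws -sum1_card; apply: eq_bigl => P.
rewrite !inE -andbA; apply: andb_id2l => _; apply/andP/eqP=> [[leP /eqP <-]|cP].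
  by rewrite inordK.
by rewrite cP -ltnS ltn_ord inord_val eqxx.
Qed.

(** An invariant set is a union of cycles, hence determined by the set of at most
    |I| cycles that it meets. *)
Lemma invariant_sets_le d : (#|escape_sets d 0| <= few_subsets d)%N.
Proof.
rewrite -(card_few_subsets d (erefl m)).
have inv I : I \in escape_sets d 0 -> forall x, x \in I -> s x \in I.
  rewrite inE => /andP[_]; rewrite cards_eq0 setD_eq0 => /subsetP sI x Ix.
  by apply/sI/imset_f.
rewrite -(card_in_imset (f := fun I : {set T} => porbit s @: I)).
  apply/subset_leq_card/subsetP=> _ /imsetP[I EI ->]; rewrite inE; apply/andP; split.
    by apply/subsetP=> _ /imsetP[x _ ->]; apply: imset_f.
  by move: EI; rewrite inE => /andP[/eqP <- _]; apply: leq_imset_card.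
have rec I : I \in escape_sets d 0 -> I = [set x | porbit s x \in porbit s @: I].
  move=> EI; apply/setP=> x; rewrite inE; apply/idP/imsetP=> [Ix|[y Iy]]; first by exists x.
  move/eqP; rewrite eq_porbit_mem => /porbitP[k ->].
  by elim: k => [|k IHk]; [rewrite expg0 perm1 | rewrite expgSr permM; apply: inv].
by move=> I J /rec {2}-> /rec {2}-> ->.
Qed.

Lemma escape_sets_bound d j :
  (#|escape_sets d j| * j`! <= n ^ j * 2 ^ d * few_subsets (d - j))%N.
Proof.
elim: d j => [|d IHd] [|j]; try by rewrite escape_sets0.
- by rewrite fact0 muln1 expn0 !mul1n; apply: invariant_sets_le.
- rewrite fact0 muln1 expn0 mul1n subn0; apply: leq_trans (invariant_sets_le _) _.
  by rewrite leq_pmull ?expn_gt0.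
rewrite subSS; have [ltdj|ltjd] := ltnP d j; first by rewrite escape_sets0.
have fewS : (few_subsets (d - j.+1) <= few_subsets (d - j))%N.
  case: (d - j)%N (subnS d j) => [|k] -> //; exact: few_subsetsS.
have le1 : (#|escape_sets d j.+1| * j.+1`! <= n ^ j.+1 * 2 ^ d * few_subsets (d - j))%N.
  by apply: leq_trans (IHd _) _; rewrite leq_mul2l fewS orbT.
have le2 := IHd j; have := escape_sets_rec d j.
move: le1 le2; rewrite factS !expnS.
set N' := #|escape_sets d.+1 _|; set N1 := #|escape_sets d _|; set N0 := #|escape_sets d j|.
move: (few_subsets _) (2 ^ d)%N (n ^ j)%N j`! => g p q f le1 le2 le3.
have := leq_mul le3 (leqnn f); have := leq_mul (leqnn n) le2; nia.
Qed.
End EscapeCount.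

(** * Character ratios at low level *)

Section Ratio.
Variable T : finType.
Implicit Types (S I : {set T}) (s t g h : {perm T}).
Local Notation n := #|T|.

Lemma Alt_homogeneous S I : #|S| = #|I| -> (#|S| + 2 <= n)%N ->
  exists2 c, c \in 'Alt_T & c @: S = I.
Proof.
move=> cSI ltS.
have := ntransitive_weak (_ : #|S| <= n.-2)%N (Alt_trans T) => /(_ _)/atransP2.
have le : (#|S| <= n.-2)%N by lia.
have sz (J : {set T}) : #|J| == #|S| -> size (enum J) == #|S| by rewrite -cardE.
pose tS := Tuple (sz S (eqxx _)); have szI : #|I| == #|S| by rewrite cSI.
pose tI := Tuple (sz I szI).
move=> /(_ le tS tI) [||c Ac /(congr1 val) /= tIE].
- by apply/dtuple_onP; split=> [|i]; [apply/tuple_uniqP/enum_uniq|rewrite inE].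
- by apply/dtuple_onP; split=> [|i]; [apply/tuple_uniqP/enum_uniq|rewrite inE].
exists c => //; apply/setP=> x; rewrite -(mem_enum I) tIE.
by apply/imsetP/mapP=> -[y]; [exists y | exists y]; rewrite ?mem_enum // -mem_enum.
Qed.

Lemma sum_Alt_imset (f : {set T} -> algC) S : (#|S| + 2 <= n)%N ->
  'C(n, #|S|)%:R * (\sum_(g in 'Alt_T) f (g @: S)) =
  #|'Alt_T|%:R * \sum_(I : {set T} | #|I| == #|S|) f I.
Proof.
move=> ltS.
pose F I := #|[set g in 'Alt_T | g @: S == I]|.
have FE I : #|I| == #|S| -> F I = F S.
  move=> /eqP cI; have [c Ac cS] := Alt_homogeneous (esym cI) ltS.
  rewrite /F -(card_imset [set g in 'Alt_T | g @: S == S] (mulIg c)).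
  apply: eq_card => g; rewrite inE; apply/andP/imsetP.
    case=> Ag /eqP gS; exists (g * c^-1)%g; last by rewrite mulgKV.
    rewrite inE groupM ?groupV //=; apply/eqP.
    rewrite (eq_imset _ (permM _ _)) imset_comp gS -cS -imset_comp.
    by rewrite -[RHS]imset_id; apply: eq_imset => x /=; rewrite permK.
  case=> h; rewrite inE => /andP[Ah /eqP hS] ->; split; first exact: groupM.
  by rewrite (eq_imset _ (permM _ _)) imset_comp hS cS.
have part (f' : {set T} -> algC) : \sum_(g in 'Alt_T) f' (g @: S) =
    (F S)%:R * \sum_(I : {set T} | #|I| == #|S|) f' I.
  rewrite (partition_big (fun g : {perm T} => g @: S) (fun I => #|I| == #|S|)) /=; last first.
    by move=> g _; rewrite (card_imset _ (@perm_inj _ g)).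
  rewrite mulr_sumr; apply: eq_bigr => I cI; rewrite -(FE I cI) /F.
  rewrite mulr_natl -sumr_const; apply: eq_big => [g|g /andP[_ /eqP->] //].
  by rewrite inE.
have cA : #|'Alt_T|%:R = (F S)%:R * 'C(n, #|S|)%:R :> algC.
  have := part (fun=> 1); rewrite !sumr_const => ->; congr (_ * _%:R).
  by rewrite -card_draws; apply: eq_card => I; rewrite inE.
by rewrite cA part mulrA (mulrC 'C(_, _)%:R).
Qed.

Lemma escapeJ S s g : escape S (s ^ g)%g = escape (g^-1%g @: S) s.
Proof.
have imJ (J : {set T}) : (s ^ g)%g @: J = g @: (s @: (g^-1%g @: J)).
  by rewrite -!imset_comp; apply: eq_imset => x; rewrite /= conjgE !permM.
rewrite /escape imJ -[RHS](card_imset _ (@perm_inj _ g)); apply: eq_card => y.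
by rewrite -(permKV g y) (mem_imset _ _ (@perm_inj _ g)) !in_setD (mem_imset _ _ (@perm_inj _ g)) im_permV inE.
Qed.

(** The ratio chi(s) / chi(1) is the average over g of the normalised sum
    k(s ^ g) / k(1), and s ^ g moves as many points out of S as s moves out of
    the translate of S by g^-1. *)
Lemma irr_ratio_escape (i : Iirr 'Alt_T) S s : s \in 'Alt_T ->
    (2 * #|S| + 2 <= n)%N ->
    {in S, forall x, \sum_(h in fixer (S :\ x)) 'chi_i h = 0} ->
    \sum_(h in fixer S) 'chi_i h != 0 ->
  `|'chi_i s| * 'C(n, #|S|)%:R <= 'chi_i 1%g *
     \sum_(I : {set T} | #|I| == #|S|) (escape I s)`!%:R / (n - 2 * #|S|)%:R ^+ escape I s.
Proof.
move=> As ltS chi0 chiS.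
set N := (n - _)%N; pose w j : algC := j`!%:R / N%:R ^+ j.
have N0 : (0 < N%:R :> algC) by rewrite ltr0n /N; lia.
have k1E : fixer_sum 'chi_i S 1 = \sum_(h in fixer S) 'chi_i h.
  by apply: eq_bigr => h _; rewrite mul1g.
have k1 : 0 < fixer_sum 'chi_i S 1.
  by rewrite lt_def k1E chiS (char_sum_ge0 (fixer_sub_Alt S)) ?irr_char.
have X0 := irr1_gt0 i.
have le_k t : t \in 'Alt_T -> `|fixer_sum 'chi_i S t| <= w (escape S t) * fixer_sum 'chi_i S 1.
  move=> At; rewrite /w mulrAC ler_pdivlMr ?exprn_gt0 //.
  exact: fixer_sum_decay (irr_char i) At ltS chi0.
have avg : \sum_(g in 'Alt_T) fixer_sum 'chi_i S (s ^ g)%g =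
   #|'Alt_T|%:R * ('chi_i s * fixer_sum 'chi_i S 1 / 'chi_i 1%g).
  rewrite exchange_big k1E /=.
  transitivity (\sum_(h in fixer S) #|'Alt_T|%:R * ('chi_i s * 'chi_i h / 'chi_i 1%g)).
    apply: eq_bigr => h /(subsetP (fixer_sub_Alt S)) Ah; exact: irr_class_average.
  by rewrite -mulr_sumr -!mulr_suml -mulr_sumr.
have G0 : (0 < #|'Alt_T|%:R :> algC) by rewrite ltr0n cardG_gt0.
have : #|'Alt_T|%:R * (`|'chi_i s| / 'chi_i 1%g) <= \sum_(g in 'Alt_T) w (escape (g @: S) s).
  rewrite -(ler_pM2r k1) mulr_suml.
  have -> : #|'Alt_T|%:R * (`|'chi_i s| / 'chi_i 1%g) * fixer_sum 'chi_i S 1 =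
     `|\sum_(g in 'Alt_T) fixer_sum 'chi_i S (s ^ g)%g|.
    rewrite avg !normrM normr_nat normfV (gtr0_norm k1) (gtr0_norm X0) -!(@mulrA algC).
    by congr (_ * (_ * _)); rewrite mulrC.
  rewrite [X in _ <= X](reindex_inj invg_inj) /=.
  apply: le_trans (ler_norm_sum _ _ _) _.
  rewrite [X in _ <= X](eq_bigl (mem 'Alt_T)) => [|g]; last by rewrite groupV.
  by apply: ler_sum => g Ag; rewrite -escapeJ le_k ?groupJ.
rewrite -(ler_pM2l (_ : 0 < 'C(n, #|S|)%:R)); last by rewrite ltr0n bin_gt0; lia.
rewrite (sum_Alt_imset (fun I => w (escape I s))); last by lia.
rewrite mulrCA ler_pM2l // [X in X <= _](_ : _ = `|'chi_i s| * 'C(n, #|S|)%:R / 'chi_i 1%g).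
  by rewrite ler_pdivrMr // [X in _ <= X]mulrC.
by rewrite mulrA [_ * `|_|]mulrC.
Qed.

Lemma leq_exp2rW k p d : (k <= p)%N -> (k ^ d <= p ^ d)%N.
Proof. by case: d => // d lekp; rewrite leq_exp2r. Qed.

Lemma ffact_le_exp k d : (k ^_ d <= k ^ d)%N.
Proof.
rewrite ffact_prod -[X in (_ <= k ^ X)%N]card_ord -prod_nat_const.
by apply: leq_prod => i _; apply: leq_subr.
Qed.

Lemma exp_le_binomial k d : (2 * d <= k)%N -> (k ^ d <= 2 ^ d * (d`! * 'C(k, d)))%N.
Proof.
move=> le2; rewrite (mulnC d`!) bin_ffact ffact_prod.
have exps x : (x ^ d)%N = (\prod_(i < d) x)%N by rewrite prod_nat_const card_ord.
rewrite !exps -big_split /=; apply: leq_prod => i _.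
by have := ltn_ord i; lia.
Qed.

Lemma fact_few_subsets_le s d M : (d <= M)%N -> (#|porbits s| <= M)%N ->
  (d`! * few_subsets s d <= d.+1 * M ^ d)%N.
Proof.
move=> ledM lemM; rewrite /few_subsets big_distrr /= -[X in (_ <= X * _)%N](card_ord d.+1).
rewrite -sum_nat_const; apply: leq_sum => i _; have leid : (i <= d)%N by rewrite -ltnS.
have := ffact_fact (leq_subr i d); rewrite subKn // => <-.
rewrite -mulnA (mulnC i`!) bin_ffact .
have -> : (M ^ d = M ^ (d - i) * M ^ i)%N by rewrite -expnD subnK.
have le_pow k p : (k <= M)%N -> (k ^_ p <= M ^ p)%N.
  by move=> lek; rewrite (leq_trans (ffact_le_exp _ _)) // leq_exp2rW.
by rewrite leq_mul ?le_pow.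
Qed.

(** The factorial gained in the decay cancels the one in the count of sets with j
    escaping points, so that each j costs only a factor 2 ^ j. *)
Lemma escape_weight_le s d : (4 * d <= n)%N -> (0 < n)%N ->
  \sum_(I : {set T} | #|I| == d) (escape I s)`!%:R / (n - 2 * d)%:R ^+ escape I s
    <= (2 ^ (2 * d + 1) * few_subsets s d)%:R :> algC.
Proof.
move=> le4 n0; set N := (n - _)%N.
have N0 : (0 < N%:R :> algC) by rewrite ltr0n /N; lia.
rewrite (partition_big (fun I : {set T} => inord (escape I s) : 'I_d.+1) xpredT) //=.
have -> : (2 * d + 1 = d.+1 + d)%N by lia.
have few_mono k : (few_subsets s (d - k) <= few_subsets s d)%N.
  elim: k => [|k IHk]; first by rewrite subn0.
  by apply: leq_trans IHk; rewrite subnS; case: (d - k)%N => //= p; apply: few_subsetsS.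
apply: (@le_trans _ _ (\sum_(j < d.+1) (2 ^ j * (2 ^ d * few_subsets s d))%:R)).
  apply: ler_sum => j _.
  rewrite (eq_bigr (fun=> j`!%:R / N%:R ^+ j)); last first.
    move=> I /andP[/eqP cI /eqP <-]; rewrite inordK // ltnS -cI; exact: escape_le.
  rewrite (eq_bigl (mem (escape_sets s d j))); last first.
    move=> I; rewrite /= inE; apply: andb_id2l => /eqP cI.
    apply/eqP/eqP=> [<-|->]; last by rewrite inord_val.
    by rewrite inordK // ltnS -cI; apply: escape_le.
  rewrite sumr_const -[_ *+ #|_|]mulr_natl mulrA ler_pdivrMr ?exprn_gt0 // -natrX -!natrM ler_nat.
  apply: leq_trans (escape_sets_bound s d j) _.
  rewrite -mulnA [X in (_ <= X)%N]mulnAC -expnMn leq_mul //; last by rewrite leq_mul2l few_mono orbT.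
  by rewrite leq_exp2rW // /N; lia.
rewrite -natr_sum ler_nat -big_distrl /= expnD -mulnA leq_mul //.
have : (\sum_(j < d.+1) 2 ^ j = 2 ^ d.+1 - 1)%N.
  elim: {few_mono le4 N N0}d => [|d IHd]; first by rewrite big_ord1.
  by rewrite big_ord_recr /= IHd (expnS 2 d.+1); have := expn_gt0 2 d.+1; lia.
by move=> ->; rewrite leq_subr.
Qed.

Lemma irr_ratio_bound (i : Iirr 'Alt_T) S s M : s \in 'Alt_T ->
    (0 < #|S|)%N -> (4 * #|S| <= n)%N -> (#|S| <= M)%N -> (#|porbits s| <= M)%N ->
    {in S, forall x, \sum_(h in fixer (S :\ x)) 'chi_i h = 0} ->
    \sum_(h in fixer S) 'chi_i h != 0 ->
  `|'chi_i s| * n%:R ^+ #|S| <= 'chi_i 1%g * (32 * M)%:R ^+ #|S|.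
Proof.
move=> As; set d := #|S| => d0 le4 ledM lemM chi0 chiS.
have := irr_ratio_escape As _ chi0 chiS; rewrite -/d => /(_ _)-le0.
have {le0} := le0 ltac:(lia).
set W := \sum_(I | _) _ => le0.
have leW : W <= (2 ^ (2 * d + 1) * few_subsets s d)%:R.
  by apply: escape_weight_le => //; lia.
have X0 := irr1_gt0 i.
have le1 : (n ^ d <= 2 ^ d * (d`! * 'C(n, d)))%N by apply: exp_le_binomial; lia.
have le2 := fact_few_subsets_le ledM lemM.
have le3 : (2 ^ (3 * d + 1) * d.+1 <= 32 ^ d)%N.
  rewrite expnD expnM -[32%N]/(8 * 4)%N expnMn -mulnA leq_mul2l; apply/orP; right.
  by rewrite expn1; case: (d) d0 => // e _; elim: e => // e IHe; rewrite expnS; lia.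
apply: (@le_trans _ _ ('chi_i 1%g * (W * (2 ^ d * d`!)%:R))).
  rewrite -natrX; apply: (@le_trans _ _ (`|'chi_i s| * (2 ^ d * (d`! * 'C(n, d)))%:R)).
    by rewrite ler_wpM2l // ler_nat.
  by rewrite mulnA natrM (mulrC (_ * _)%:R) !(@mulrA algC) ler_wpM2r // ler0n.
rewrite ler_wpM2l ?(ltW X0) //.
apply: (@le_trans _ _ ((2 ^ (2 * d + 1) * few_subsets s d)%:R * (2 ^ d * d`!)%:R)).
  by rewrite ler_wpM2r ?ler0n.
rewrite -natrM -natrX ler_nat expnMn.
apply: leq_trans (leq_mul le3 (leqnn (M ^ d))).
rewrite -[X in (_ <= X)%N]mulnA; apply: leq_trans (leq_mul (leqnn _) le2).
rewrite (_ : 3 * d + 1 = (2 * d + 1) + d)%N; last by lia.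
by rewrite [(2 ^ (_ + d))%N]expnD; nia.
Qed.
End Ratio.

(** * Degrees at high level *)

Section ThreeCycles.
Variable T : finType.
Implicit Types (U V : {set T}) (g h : {perm T}) (x y z : T).
Local Notation n := #|T|.

(** The 3-cycle x -> y -> z -> x. *)
Definition cycle3 x y z : {perm T} := (tperm x y * tperm x z)%g.

Lemma cycle3_fixer U x y z : x != y -> x != z -> x \notin U -> y \notin U -> z \notin U ->
  cycle3 x y z \in fixer U.
Proof.
move=> xy xz Ux Uy Uz; apply/fixerP; split.
  by rewrite Alt_even odd_permM !odd_tperm xy xz.
move=> w Uw; have nw v : v \notin U -> v != w by apply: contraNneq => ->.
by rewrite permM !tpermD ?nw.
Qed.

Lemma cycle3J x y z g : (cycle3 x y z ^ g)%g = cycle3 (g x) (g y) (g z).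
Proof. by rewrite conjMg !tpermJ. Qed.

Lemma cycle3V x y z : (cycle3 x y z)^-1%g = cycle3 x z y.
Proof. by rewrite invMg !tpermV. Qed.

(** Induction on the number of free points: a 3-cycle brings the image of a free
    point v back to v, at the expense of any third free point. *)
Lemma fixer_generated U (K : {group {perm T}}) :
    (forall x y z, x != y -> x != z -> y != z -> x \notin U -> y \notin U -> z \notin U ->
      cycle3 x y z \in K) ->
  fixer U \subset K.
Proof.
move=> cK.
suff gen k V : #|~: V| = k -> U \subset V -> fixer V \subset K by exact: gen (erefl _) _.
elim: k V => [|k IHk] V cV sUV; apply/subsetP=> h Vh; have /fixerP[Ah hV] := Vh.
  have VT x : x \in V by have /setP/(_ x) := cards0_eq cV; rewrite !inE => /negbFE.
  suff -> : h = 1%g by []; apply/permP=> x; rewrite hV ?perm1 //.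
have /card_gt0P[v] : (0 < #|~: V|)%N by rewrite cV.
rewrite inE => Vv; set w := h v.
have notU x : x \notin V -> x \notin U by apply: contra; apply: (subsetP sUV).
have Vw : w \notin V by apply: contra Vv => Vw; rewrite -(perm_inj (hV _ Vw)).
have subK : fixer (v |: V) \subset K.
  apply: IHk; last by apply: subset_trans sUV (subsetUr _ _).
  by have := cardsC V; have := cardsC (v |: V); rewrite cardsU1 Vv cV; lia.
have [wv|wv] := eqVneq w v.
  apply: (subsetP subK); apply/fixerP; split=> // x; rewrite !inE => /orP[/eqP->//|/hV//].
have [z zP|noz] := pickP (fun z => [&& z \notin V, z != v & z != w]).
  have /and3P[Vz zv zw] := zP.
  have cKwvz : cycle3 w v z \in K by apply: cK; rewrite ?notU // eq_sym.
  rewrite -(groupMr _ cKwvz); apply: (subsetP subK); apply/fixerP.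
  have /fixerP[Ac cV'] : cycle3 w v z \in fixer V by apply: cycle3_fixer; rewrite // eq_sym.
  split=> [|x]; first by rewrite groupM.
  rewrite !inE permM => /orP[/eqP->|Vx]; last by rewrite hV ?cV'.
  by rewrite -/w permM tpermL tpermD // eq_sym.
(* No third free point exists, so h is a transposition and thus odd. *)
suff hE : h = tperm v w by move: Ah; rewrite Alt_even hE odd_tperm eq_sym wv.
apply/permP=> x; case: tpermP => [->|->|/eqP xv /eqP xw] //; last first.
  by apply: hV; move: (noz x); rewrite xv xw !andbT => /negbFE.
have hw : h w \notin V by apply: contra Vw => Vhw; rewrite -(perm_inj (hV _ Vhw)).
move: (noz (h w)); rewrite hw /= (inj_eq (@perm_inj _ h)) wv andbT => /negbFE/eqP //.
Qed.

Lemma exists_fixer_map3 U x y z x' y' z' : (#|U| + 5 <= n)%N ->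
    uniq [:: x; y; z] -> uniq [:: x'; y'; z'] ->
    x \notin U -> y \notin U -> z \notin U -> x' \notin U -> y' \notin U -> z' \notin U ->
  exists2 g, g \in fixer U & [/\ g x = x', g y = y' & g z = z'].
Proof.
rewrite /= !inE !negb_or !andbT => ltU /andP[/andP[xy xz] yz] /andP[/andP[x'y' x'z'] y'z'].
move=> Ux Uy Uz Ux' Uy' Uz'.
have keep V g v : g \in fixer V -> v \notin V -> g v \notin V.
  by move=> /fixerP[_ gV]; apply: contra => Vgv; rewrite -(perm_inj (gV _ Vgv)).
have [a Ua ax] := exists_fixer_map Ux Ux' (leq_trans (leq_add (leqnn _) (isT : 3 <= 5)%N) ltU).
pose U1 := x' |: U.
have cU1 : #|U1| = #|U|.+1 by rewrite cardsU1 Ux'.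
have U1ay : a y \notin U1 by rewrite !inE negb_or (keep U) // andbT -ax (inj_eq perm_inj) eq_sym.
have U1az : a z \notin U1 by rewrite !inE negb_or (keep U) // andbT -ax (inj_eq perm_inj) eq_sym.
have U1y' : y' \notin U1 by rewrite !inE negb_or Uy' andbT eq_sym.
have lt1 : (#|U1| + 3 <= n)%N by rewrite cU1 addSnnS (leq_trans _ ltU) // leq_add2l.
have [b U1b bay] := exists_fixer_map U1ay U1y' lt1.
pose U2 := y' |: U1.
have cU2 : #|U2| = #|U|.+2 by rewrite cardsU1 U1y' cU1.
have U2z' : z' \notin U2 by rewrite !inE !negb_or Uz' andbT ![z' == _]eq_sym y'z'.
have U2baz : b (a z) \notin U2.
  by rewrite in_setU1 negb_or (keep U1) // andbT -bay !(inj_eq perm_inj) eq_sym.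
have lt2 : (#|U2| + 3 <= n)%N by rewrite cU2 !addSnnS.
have [c U2c cbaz] := exists_fixer_map U2baz U2z' lt2.
have sU1 : U \subset U1 by apply: subsetUr.
have sU2 : U1 \subset U2 by apply: subsetUr.
exists (a * b * c)%g.
  have Ub := subsetP (fixerS sU1) b U1b.
  have Uc := subsetP (fixerS (subset_trans sU1 sU2)) c U2c.
  by rewrite !groupM.
have /fixerP[_ b1] := U1b; have /fixerP[_ c2] := U2c.
rewrite !permM ax bay cbaz b1 ?setU11 // !c2 ?setU11 //.
by rewrite in_setU1 setU11 orbT.
Qed.
End ThreeCycles.

Section Degree.
Variable T : finType.
Implicit Types (U V : {set T}).
Local Notation n := #|T|.

Lemma exists_outside U : (#|U| < n)%N -> exists x, x \notin U.
Proof.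
move=> ltU; have /card_gt0P[x] : (0 < #|~: U|)%N by have := cardsC U; lia.
by rewrite inE => Ux; exists x.
Qed.

Lemma exists_two_outside U : (#|U| + 2 <= n)%N ->
  exists d e, [/\ d \notin U, e \notin U & e != d].
Proof.
move=> ltU; have [d Ud] := @exists_outside U ltac:(lia).
have [e] := @exists_outside (d |: U) ltac:(by rewrite cardsU1 Ud; lia).
by rewrite !inE negb_or => /andP[ed Ue]; exists d, e.
Qed.

Lemma card_setU3 U x y z : uniq [:: x; y; z] -> x \notin U -> y \notin U -> z \notin U ->
  #|U :|: [set x; y; z]| = (#|U| + 3)%N.
Proof.
rewrite /= !inE negb_or => /andP[/andP[xy xz] /andP[yz _]] Ux Uy Uz.
have -> : U :|: [set x; y; z] = z |: (y |: (x |: U)).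
  by apply/setP=> w; rewrite !inE; case: (w == x); case: (w == y); case: (w == z); rewrite ?orbT ?orbF.
rewrite !cardsU1 !inE (eq_sym z y) (eq_sym z x) (eq_sym y x).
by rewrite (negPf xy) (negPf xz) (negPf yz) (negPf Ux) (negPf Uy) (negPf Uz) [RHS]addnC.
Qed.

Lemma exists_three_outside U : (#|U| + 3 <= n)%N ->
  exists x y z, [/\ uniq [:: x; y; z], x \notin U, y \notin U & z \notin U].
Proof.
move=> ltU; have [x Ux] := @exists_outside U ltac:(lia).
have [y [z]] := @exists_two_outside (x |: U) ltac:(by rewrite cardsU1 Ux; lia).
rewrite !inE !negb_or => -[/andP[yx Uy] /andP[zx Uz] zy].
by exists x, y, z; rewrite /= !inE negb_or (eq_sym x) yx (eq_sym x) zx (eq_sym y) zy.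
Qed.

(** If the restriction stays irreducible, the 3-cycle c on the three new points,
    which commutes with the smaller group, is a scalar. As c is conjugate to its
    inverse, c and c^-1 are the same scalar; since c = c^-2 this scalar is 1. So
    all 3-cycles act trivially, and they generate. *)
Lemma Res_fixer_irr_trivial U x y z (i : Iirr (fixer U)) : (#|U| + 5 <= n)%N ->
    uniq [:: x; y; z] -> x \notin U -> y \notin U -> z \notin U ->
    'Res[fixer (U :|: [set x; y; z])] 'chi_i \in irr (fixer (U :|: [set x; y; z])) ->
  cfker 'chi_i = fixer U.
Proof.
move=> ltU uxyz Ux Uy Uz /irrP[j resE].
set V := U :|: _ in j resE.
have /and3P[xyz yz _] := uxyz; move: xyz yz; rewrite !inE negb_or => /andP[xy xz] yz.
have sVU : fixer V \subset fixer U by apply/fixerS/subsetUl.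
pose rG := 'Chi_i; pose rV := subg_repr rG sVU.
have absV : mx_absolutely_irreducible rV.
  have sim : mx_rsim 'Chi_j rV by apply: cfRepr_inj; rewrite cfRepr_sub !irrRepr.
  by rewrite -(mx_rsim_abs_irr sim); apply/groupC/socle_irr.
set c := cycle3 x y z.
have Uc : c \in fixer U by apply: cycle3_fixer.
have comV : centgmx rV (rG c).
  apply/centgmxP=> h /[dup] Vh /fixerP[_ hV]; have Uh := subsetP sVU h Vh.
  have hc : (c * h = h * c)%g by rewrite conjgC /c cycle3J !hV // !inE eqxx ?orbT.
  by rewrite /= -!repr_mxM // hc.
have /is_scalar_mxP[l cl] := mx_abs_irr_cent_scalar absV comV.
have kc : c \in cfker 'chi_i.
  have [d [e [[Ud dx dy dz] [Ue ex ey ez] ed]]] : exists d e,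
      [/\ [/\ d \notin U, d != x, d != y & d != z],
          [/\ e \notin U, e != x, e != y & e != z] & e != d].
    have [|d [e []]] := @exists_two_outside (U :|: [set x; y; z]).
      by rewrite card_setU3 // -addnA.
    rewrite !inE !negb_or => /andP[Ud /andP[/andP[dx dy] dz]].
    by move=> /andP[Ue /andP[/andP[ex ey] ez]] ed; exists d, e.
  (* The transposition of y and z inverts c; that of d and e makes g even. *)
  pose g := (tperm y z * tperm d e)%g.
  have Ug : g \in fixer U.
    apply/fixerP; split; first by rewrite Alt_even odd_permM !odd_tperm yz eq_sym ed.
    move=> w Uw; have nw v : v \notin U -> v != w by apply: contraNneq => ->.
    by rewrite permM !tpermD ?nw.
  have gx : g x = x by rewrite permM (tpermD (x := y)) ?tpermD // eq_sym.
  have gy : g y = z by rewrite permM tpermL tpermD.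
  have gz : g z = y by rewrite permM tpermR tpermD.
  have cg : (c ^ g)%g = c^-1%g by rewrite cycle3J cycle3V gx gy gz.
  have cl' : rG c^-1%g = l%:M.
    rewrite -cg conjgE (repr_mxM rG (groupVr Ug) (groupM Uc Ug)) (repr_mxM rG Uc Ug).
    rewrite cl mul_scalar_mx -scalemxAr.
    by rewrite -repr_mxM ?groupV // mulVg repr_mx1 scalemx1.
  have cc : (c^-1 * c^-1)%g = c.
    rewrite cycle3V /c /cycle3.
    have e1 : (tperm x z * tperm x y * tperm x z = tperm x y * tperm x z * tperm x y)%g.
      transitivity (tperm x y ^ tperm x z)%g; first by rewrite conjgE tpermV mulgA.
      transitivity (tperm x z ^ tperm x y)%g; last by rewrite conjgE tpermV mulgA.
      by rewrite !tpermJ !tpermL (tpermD xz yz) (tpermD xy) 1?eq_sym // tpermC.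
    by rewrite mulgA e1 -mulgA tperm2 mulg1.
  have -> : cfker 'chi_i = rker rG by rewrite -cfker_repr irrRepr.
  apply/rkerP; split=> //.
  by rewrite -cc repr_mxM ?groupV // [X in X *m _](etrans cl' (esym cl)) -repr_mxM ?groupV // mulgV repr_mx1.
apply/eqP; rewrite eqEsubset cfker_sub; apply: fixer_generated => x' y' z' xy' xz' yz' Ux' Uy' Uz'.
have ux'y'z' : uniq [:: x'; y'; z'] by rewrite /= !inE negb_or xy' xz' yz'.
have [g Ug [gx gy gz]] := exists_fixer_map3 ltU uxyz ux'y'z' Ux Uy Uz Ux' Uy' Uz'.
by rewrite -gx -gy -gz -cycle3J memJ_norm // (subsetP (cfker_norm _)).
Qed.

(** Fixing three more points splits the representation into at least two pieces,
    none of which has vectors fixed by the stabiliser of a small set. *)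
Lemma irr_degree_fixer t U (i : Iirr (fixer U)) : (#|U| + 3 * t + 2 <= n)%N ->
    (forall V, U \subset V -> (#|V| < #|U| + 3 * t)%N -> \sum_(h in fixer V) 'chi_i h = 0) ->
  (2 ^ t)%:R <= 'chi_i 1%g.
Proof.
elim: t U i => [|t IHt] U i ltU chi0.
  by rewrite irr1_degree ler_nat irr_degree_gt0.
have lt3 : (#|U| + 3 <= n)%N by lia.
have lt5 : (#|U| + 5 <= n)%N by lia.
have lt3t : (#|U| < #|U| + 3 * t.+1)%N by lia.
have eq3t : (#|U| + 3 * t.+1 = #|U| + 3 + 3 * t)%N by lia.
have [x [y [z [uxyz Ux Uy Uz]]]] := exists_three_outside lt3.
set V := U :|: [set x; y; z].
have sVU : fixer V \subset fixer U by apply/fixerS/subsetUl.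
have cV : #|V| = (#|U| + 3)%N by apply: card_setU3.
have NR : 'Res[fixer V] 'chi_i \is a character by rewrite cfRes_char ?irr_char.
have [j jR] := neq0_has_constt (Res_irr_neq0 (fixer V) i).
have [psi Npsi resE] := constt_charP j NR jR.
have [psi0|psi0] := eqVneq psi 0.
  have kerU : cfker 'chi_i = fixer U.
    apply: (Res_fixer_irr_trivial lt5 uxyz) => //.
    by rewrite -/V resE psi0 addr0 mem_irr.
  have := chi0 U (subxx _) lt3t; rewrite (eq_bigr (fun=> 'chi_i 1%g)).
    by rewrite sumr_const => /eqP; rewrite mulrn_eq0 (negPf (irr1_neq0 i)) orbF eqn0Ngt cardG_gt0.
  by move=> h Uh; apply: cfker1; rewrite kerU.
have [k kpsi] := neq0_has_constt psi0.
have [psi' Npsi' psiE] := constt_charP k Npsi kpsi.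
have sum0 (W : {set T}) : V \subset W -> (#|W| < #|V| + 3 * t)%N ->
    \sum_(h in fixer W) 'chi_j h = 0 /\ \sum_(h in fixer W) 'chi_k h = 0.
  move=> sVW ltW; have sWV := fixerS sVW.
  have := chi0 W (subset_trans (subsetUl _ _) sVW); rewrite eq3t -cV => /(_ ltW).
  have -> : \sum_(h in fixer W) 'chi_i h = \sum_(h in fixer W) 'chi_j h +
      (\sum_(h in fixer W) 'chi_k h + \sum_(h in fixer W) psi' h).
    rewrite -!big_split; apply: eq_bigr => h Wh /=.
    have Vh := subsetP sWV h Wh.
    by rewrite -(cfResE 'chi_i sVU Vh) resE psiE !cfunE.
  have pj := char_sum_ge0 sWV (irr_char j); have pk := char_sum_ge0 sWV (irr_char k).
  have pp := char_sum_ge0 sWV Npsi'.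
  move/eqP; rewrite paddr_eq0 ?addr_ge0 // => /andP[/eqP-> ].
  by rewrite paddr_eq0 // => /andP[/eqP-> _].
have ltV : (#|V| + 3 * t + 2 <= n)%N by rewrite cV -eq3t.
have lej := IHt V j ltV (fun W sW lW => (sum0 W sW lW).1).
have lek := IHt V k ltV (fun W sW lW => (sum0 W sW lW).2).
have -> : 'chi_i 1%g = 'chi_j 1%g + ('chi_k 1%g + psi' 1%g).
  by rewrite -(cfResE 'chi_i sVU (group1 _)) resE psiE !cfunE.
rewrite expnS mul2n -addnn natrD lerD // (le_trans lek) // lerDl.
exact: char1_ge0.
Qed.
End Degree.

(** * Permutations with many cycles *)

Section ManyCycles.
Local Open Scope nat_scope.
Variable T : finType.
Local Notation n := #|T|.

(** A permutation supported in v |: S is uniquely tperm v w * s with s supported in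
    S; for w != v the transposition merges the fixed point v into the cycle of w. *)
Lemma sum_cycles_setU1 x (S : {set T}) v : v \notin S ->
  (x * \sum_(s : {perm T} | perm_on (v |: S) s) x ^ #|porbits s| =
   (x + #|S|) * \sum_(s : {perm T} | perm_on S s) x ^ #|porbits s|)%N.
Proof.
move=> Sv.
rewrite (partition_big (fun s : {perm T} => s^-1%g v) (mem (v |: S))) /=; last first.
  by move=> s /perm_onV sS; rewrite (perm_closed _ sS) setU11.
have onE w (s : {perm T}) : w \in v |: S ->
    perm_on (v |: S) (tperm v w * s)%g && ((tperm v w * s)^-1%g v == w) = perm_on S s.
  move=> Sw; apply/andP/idP=> [[onvS /eqP ew]|onS].
    have sv : s v = v.
      by have := permKV (tperm v w * s)%g v; rewrite ew permM tpermR.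
    apply/subsetP=> y; rewrite inE => sy.
    have yv : y != v by apply: contraNneq sy => ->; rewrite sv.
    have : s y != y -> y \in v |: S.
      move=> _; have onT : perm_on (v |: S) (tperm v w).
        by apply/subsetP=> z; rewrite inE; case: tpermP => [->|->|]; rewrite ?eqxx // setU11.
      have : perm_on (v |: S) s by rewrite -(tpermKg v w s); apply: perm_onM.
      by move/subsetP; apply; rewrite inE.
    by move/(_ sy); rewrite in_setU1 (negPf yv).
  have sv : s v = v by apply: (out_perm onS).
  split.
    apply: perm_onM; last by apply: subset_trans onS (subsetUr _ _).
    by apply/subsetP=> z; rewrite inE; case: tpermP => [->|->|]; rewrite ?eqxx // setU11.
  by apply/eqP; apply: (canLR (permK _)); rewrite permM tpermR sv.
have cyc w (s : {perm T}) : w \in S -> perm_on S s ->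
    #|porbits s| = #|porbits (tperm v w * s)%g|.+1.
  move=> Sw onS; have wv : w != v by apply: contraNneq Sv => <-.
  have sv : s v = v by apply: (out_perm onS).
  have := porbits_mul_tperm s v w; rewrite /= eq_sym wv.
  have -> : v \notin porbit s w.
    rewrite porbit_sym; apply/negP=> /porbitP[k]; rewrite permX_fix // => /eqP.
    by rewrite (negPf wv).
  by rewrite -[true.*2]/2%N -[nat_of_bool true]/1%N addn2 addn1 => -[<-].
rewrite (eq_bigr (fun w => \sum_(s : {perm T} | perm_on S s) x ^ #|porbits (tperm v w * s)%g|)); last first.
  move=> w Sw; rewrite (reindex_inj (mulgI (tperm v w))) /=.
  by apply: eq_bigl => s; rewrite onE.
rewrite big_setU1 //= tperm1 mulnDr mulnDl; congr (_ + _)%N.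
  by congr (_ * _)%N; apply: eq_bigr => s _; rewrite mul1g.
rewrite big_distrr -sum_nat_const /=; apply: eq_bigr => w Sw.
by rewrite big_distrr /=; apply: eq_bigr => s onS; rewrite (cyc w s) // expnS.
Qed.

Lemma sum_cycles x :
  (0 < x)%N -> (\sum_(s : {perm T}) x ^ #|porbits s| = \prod_(k < n) (x + k))%N.
Proof.
move=> x0.
have gen (S : {set T}) : (x ^ #|S| * \sum_(s : {perm T} | perm_on S s) x ^ #|porbits s| =
    x ^ n * \prod_(k < #|S|) (x + k))%N.
  move: {2}#|S| (erefl #|S|) => k; elim: k S => [|k IHk] S cS.
    rewrite cS big_ord0 mul1n muln1 (cards0_eq cS).
    rewrite (big_pred1 1%g) => [|s]; last first.
      apply/idP/eqP=> [s0|->]; last exact: perm_on1.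
      by apply/permP=> y; rewrite (out_perm s0) ?inE // perm1.
    congr (x ^ _)%N; rewrite -[RHS]cardsT -(card_imset _ (set1_inj (T:=T))).
    congr #|pred_of_set _|; apply/setP=> X; apply/imsetP/imsetP=> -[y _ ->]; exists y; rewrite // ?inE //.
      by apply/setP=> z; rewrite inE; apply/porbitP/eqP=> [[j ->]|->]; [rewrite expg1n perm1 | exists 0%N; rewrite perm1].
    by apply/setP=> z; rewrite inE; apply/eqP/porbitP=> [->|[j ->]]; [exists 0%N; rewrite perm1 | rewrite expg1n perm1].
  have [v Sv] : exists v, v \in S by apply/set0Pn; rewrite -card_gt0 cS.
  have cS' : #|S :\ v| = k by move: cS; rewrite (cardsD1 v) Sv => -[].
  have Svv : v \notin S :\ v by rewrite !inE eqxx.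
  have := sum_cycles_setU1 x Svv; rewrite setD1K // cS' => H.
  have := IHk _ cS'; rewrite cS' => IH.
  rewrite cS expnS [x * x ^ k]mulnC -mulnA H mulnCA IH big_ord_recr /=.
  by rewrite mulnC mulnA.
have := gen setT; rewrite cardsT => /eqP; rewrite eqn_pmul2l ?expn_gt0 ?x0 // => /eqP <-.
by apply: eq_bigl => s; apply/esym/subsetP=> y _; rewrite inE.
Qed.

Lemma rising_le x : (0 < x)%N -> (\prod_(k < n) (x + k) <= n`! * n.+1 ^ x)%N.
Proof.
elim: x => // -[_ _|x IHx _].
  rewrite expn1 fact_prod big_add1 /= big_mkord.
  by rewrite (eq_bigr (fun k : 'I_n => k.+1)) ?leq_pmulr // => k _; rewrite add1n.
have rec : (x.+1 * \prod_(k < n) (x.+2 + k) = (x.+1 + n) * \prod_(k < n) (x.+1 + k))%N.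
  elim: (n) => [|m IHm]; first by rewrite !big_ord0 addn0.
  rewrite big_ord_recr [in RHS]big_ord_recr /= mulnA IHm.
  by move: (\prod_(k < m) _) => P; nia.
rewrite -(leq_pmul2l (ltn0Sn x)) rec expnS.
have := leq_mul (leqnn (x.+1 + n)) (IHx isT).
move/leq_trans; apply; rewrite [X in (_ <= _ * X)%N]mulnCA !mulnA leq_mul // leq_mul //.
by rewrite -[n.+1]add1n; nia.
Qed.

(** Markov's inequality for x ^ (number of cycles), whose total is a rising
    factorial. *)
Lemma card_many_cycles m x : (0 < x)%N ->
  (#|[set s : {perm T} | m < #|porbits s|]| * x ^ m <= n`! * n.+1 ^ x)%N.
Proof.
move=> x0; apply: leq_trans (rising_le x0); rewrite -sum_cycles // -sum_nat_const.
apply: (@leq_trans (\sum_(s : {perm T} | m < #|porbits s|) x ^ #|porbits s|)).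
  rewrite (eq_bigl (fun s : {perm T} => m < #|porbits s|)) => [|s]; last by rewrite inE.
  by apply: leq_sum => s lt; rewrite leq_pexp2l // ltnW.
by rewrite [leqRHS](bigID (fun s : {perm T} => m < #|porbits s|)) leq_addr.
Qed.
End ManyCycles.

(** * The level of a character *)

Section Level.
Variable T : finType.
Implicit Types (S V : {set T}) (i : Iirr 'Alt_T).
Local Notation n := #|T|.

Lemma char_sum_nat (gT : finGroupType) (G H : {group gT}) (chi : 'CF(G)) :
    H \subset G -> chi \is a character ->
  exists r : nat, \sum_(h in H) chi h = #|H|%:R * r%:R.
Proof.
move=> sHG Nchi; exists (Num.truncn '['Res[H] chi, 1]).
rewrite truncnK ?Cnat_cfdot_char ?cfRes_char ?cfun1_char //.
rewrite cfdotE mulVKf ?neq0CG //; apply: eq_bigr => h Hh.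
by rewrite cfResE // cfun1E Hh rmorph1 mulr1.
Qed.

Definition fixed_sum i S := \sum_(h in fixer S) 'chi_i h.

Lemma fixed_sum_setT i : fixed_sum i setT != 0.
Proof.
rewrite /fixed_sum (eq_bigl (pred1 1%g)) => [|h]; first by rewrite big_pred1_eq irr1_neq0.
apply/fixerP/eqP=> [[_ h1]|->]; last by split=> [|x _]; rewrite ?group1 ?perm1.
by apply/permP=> x; rewrite h1 ?inE ?perm1.
Qed.

Definition level i := #|[arg min_(S < setT | fixed_sum i S != 0) #|S|]|.

Lemma levelP i :
  exists S, [/\ #|S| = level i, fixed_sum i S != 0 &
                forall V, (#|V| < level i)%N -> fixed_sum i V = 0].
Proof.
rewrite /level; case: arg_minnP => [|S nzS minS]; first exact: fixed_sum_setT.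
exists S; split=> // V; rewrite ltnNge => /negP ltV.
by apply/eqP/negPn/negP=> /minS.
Qed.

Lemma fixer_conj S g : g \in 'Alt_T -> (fixer S :^ g)%g = fixer (g @: S).
Proof.
move=> Ag; apply/setP=> h; rewrite mem_conjg; apply/fixerP/fixerP=> -[Ah hS].
  split=> [|_ /imsetP[x Sx ->]]; first by rewrite memJ_norm ?groupV // (subsetP (normG _)) in Ah *.
  by have := hS x Sx; rewrite conjgE invgK !permM => /(canRL (permK _)); rewrite invgK.
split=> [|x Sx]; first by rewrite groupJr ?groupV.
by rewrite conjgE invgK !permM hS ?imset_f // permK.
Qed.

Lemma fixed_sum_card i S V : #|S| = #|V| -> (#|S| + 2 <= n)%N ->
  fixed_sum i S = fixed_sum i V.
Proof.
move=> cSV ltS; have [g Ag gS] := Alt_homogeneous cSV ltS.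
rewrite /fixed_sum -gS [LHS](reindex_inj (conjg_inj g^-1%g)) /=.
apply: eq_big => h; first by rewrite -mem_conjg fixer_conj.
by move=> _; rewrite cfunJ ?groupV.
Qed.

Lemma level0 i : (2 <= n)%N -> level i = 0%N -> i = 0.
Proof.
move=> n2; have [S [cS nzS _]] := levelP i => l0; rewrite l0 in cS.
apply/eqP; apply: contraTT nzS => nz_i; rewrite negbK.
have E : fixer S = 'Alt_T :> {set _}.
  apply/setP=> h; apply/fixerP/idP=> [[]//|Ah]; split=> // x.
  by rewrite (cards0_eq cS) inE.
have := cfdot_irr i 0; rewrite (negPf nz_i) cfdotE irr0 => /eqP.
rewrite mulf_eq0 invr_eq0 (negPf (neq0CG _)) /= => /eqP <-; apply/eqP.
rewrite /fixed_sum E; apply: eq_bigr => h Ah.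
by rewrite cfun1E Ah rmorph1 mulr1.
Qed.

Lemma card_Alt_fixer S : (#|S| + 2 <= n)%N -> (#|'Alt_T| <= n ^ #|S| * #|fixer S|)%N.
Proof.
move: {2}#|S| (erefl #|S|) => k; elim: k S => [|k IHk] S cS ltS.
  rewrite cS mul1n subset_leq_card //; apply/subsetP=> h Ah; apply/fixerP; split=> // x.
  by rewrite (cards0_eq cS) inE.
have [v Sv] : exists v, v \in S by apply/set0Pn; rewrite -card_gt0 cS.
have cS' : #|S :\ v| = k by move: cS; rewrite (cardsD1 v) Sv => -[].
have ltS' : (#|S :\ v| + 3 <= n)%N by rewrite cS' addnS -addSn -cS.
have Svv : v \notin S :\ v by rewrite !inE eqxx.
have dis : [disjoint ~: (S :\ v) & S :\ v] by rewrite disjoints_subset.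
have := card_fixer_move Svv dis ltS'; rewrite setD1K // => cM.
apply: leq_trans (IHk _ cS' _) _; first by apply: leq_trans ltS'; rewrite leq_add2l.
rewrite cS' cS expnSr -mulnA leq_mul2l; apply/orP; right.
apply: (@leq_trans (#|~: (S :\ v)| * #|fixer S|)); last by rewrite leq_mul2r max_card orbT.
rewrite -cM; apply/subset_leq_card/subsetP=> h /[dup] Sh /fixerP[_ hS].
rewrite inE Sh inE; apply: contra Svv => Shv.
by have /perm_inj E := hS _ Shv; rewrite -{1}E.
Qed.

(** The permutation representation on injections from a d-set into T contains
    every character of level d, and its degree is at most n ^ d. *)
Lemma sum_degree_level d : (d + 2 <= n)%N ->
  \sum_(i | level i == d) 'chi_i 1%g <= (n ^ d)%:R.
Proof.
move=> ltd.
have [S cS] : exists S, #|S| = d.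
  have : (d <= #|[set: T]|)%N by rewrite cardsT; lia.
  by case/card_geqP=> s [us cs _]; exists [set x in s]; rewrite cardsE (card_uniqP us).
have H0 : (0 < #|fixer S|%:R :> algC) by rewrite ltr0n cardG_gt0.
rewrite -(ler_pM2r H0) -natrM mulr_suml.
apply: (@le_trans _ _ #|'Alt_T|%:R); last first.
  by rewrite ler_nat -cS card_Alt_fixer // cS.
have -> : #|'Alt_T|%:R = \sum_i 'chi_i 1%g * fixed_sum i S.
  transitivity (\sum_(h in fixer S) cfReg 'Alt_T h).
    rewrite (bigD1 1%g) ?group1 //= cfRegE eqxx mulr1n big1 ?addr0 // => h /andP[_ /negPf h1].
    by rewrite cfRegE h1.
  rewrite cfReg_sum; under eq_bigr do rewrite sum_cfunE.
  rewrite exchange_big; apply: eq_bigr => i _ /=; rewrite /fixed_sum mulr_sumr.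
  by apply: eq_bigr => h _; rewrite cfunE.
rewrite [X in _ <= X](bigID (fun i => level i == d)) /= -[X in X <= _]addr0 lerD //.
  apply: ler_sum => i /eqP li; rewrite ler_pM2l ?irr1_gt0 //.
  have [V [cV nzV _]] := levelP i.
  have E : fixed_sum i V = fixed_sum i S by apply: fixed_sum_card; rewrite cV li.
  rewrite E in nzV; rewrite /fixed_sum in nzV *.
  have [r rE] := char_sum_nat (fixer_sub_Alt S) (irr_char i).
  move: nzV; rewrite rE mulf_eq0 negb_or => /andP[_]; rewrite pnatr_eq0 => r0.
  by rewrite -[X in X <= _]mulr1 ler_pM2l // ler1n lt0n.
apply: sumr_ge0 => i _; rewrite mulr_ge0 ?(ltW (irr1_gt0 i)) //.
exact: (char_sum_ge0 (fixer_sub_Alt S)) (irr_char i).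
Qed.

Lemma degree_level_ge i t : (3 * t <= level i)%N -> (3 * t + 2 <= n)%N ->
  (2 ^ t)%:R <= 'chi_i 1%g.
Proof.
move=> le3t ltn; have [_ [_ _ V0]] := levelP i.
have gen (H : {set {perm T}}) : H = fixer set0 -> forall j : Iirr H,
    (forall V, (#|V| < 3 * t)%N -> \sum_(h in fixer V) 'chi_j h = 0) -> (2 ^ t)%:R <= 'chi_j 1%g.
  move=> -> j V0j; apply: irr_degree_fixer => [|V _]; rewrite cards0 add0n //.
  exact: V0j.
apply: gen => [|V ltV]; last by apply: V0; apply: leq_trans ltV le3t.
by apply/setP=> h; apply/idP/fixerP=> [Ah|[]//]; split=> // x; rewrite inE.
Qed.
End Level.

(** * The mixing estimate *)

Section Arithmetic.
Local Open Scope nat_scope.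
Variables (n w : nat).
Hypothesis cubic_le : 2 ^ 13 * (2 ^ 9 * w ^ 2) ^ 3 <= n.
Hypothesis lt_seventh : n < w ^ 7.

Lemma w_large : 2 ^ 10 < w.
Proof.
have : 2 ^ 10 * w ^ 6 < w * w ^ 6.
  rewrite -expnS; apply: leq_ltn_trans lt_seventh; apply: leq_trans cubic_le.
  rewrite expnMn -!expnM mulnA -expnD leq_mul2r; apply/orP; right.
  by rewrite leq_exp2l.
by rewrite ltn_mul2r => /andP[].
Qed.

Lemma sixth_le : 32 * w ^ 6 <= n.
Proof.
apply: leq_trans cubic_le; rewrite expnMn -!expnM mulnA -expnD leq_mul2r; apply/orP; right.
by rewrite (@leq_exp2l 2 5).
Qed.

Lemma w_pow_le a b : a <= b -> w ^ a <= w ^ b.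
Proof. by move=> ab; rewrite leq_pexp2l // (leq_trans _ w_large). Qed.

Lemma exp_level_le d : d <= w ^ 2 -> n ^ d <= w ^ (7 * w ^ 2).
Proof.
move=> led; apply: leq_trans (leq_exp2rW d (ltnW lt_seventh)) _.
by rewrite -expnM w_pow_le // leq_mul2l.
Qed.
End Arithmetic.

Section Mixing.
Variables (T : finType) (w : nat).
Local Notation n := #|T|.
Local Notation G := 'Alt_T.
Hypothesis cubic_le : (2 ^ 13 * (2 ^ 9 * w ^ 2) ^ 3 <= n)%N.
Hypothesis lt_seventh : (n < w ^ 7)%N.
Implicit Types (A B C : {set {perm T}}) (i : Iirr G).

Let w_gt0 : (0 < w)%N.
Proof. by apply: leq_trans (w_large cubic_le lt_seventh). Qed.

Let w_ge9 : (16 <= w)%N.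
Proof. by apply: leq_trans (ltnW (w_large cubic_le lt_seventh)); rewrite (@leq_exp2l 2 4 10). Qed.

Let le4w4 : (4 * w ^ 4 <= n)%N.
Proof.
apply: leq_trans (sixth_le cubic_le); rewrite (expnD w 2 4) mulnA leq_mul2r.
by apply/orP; right; rewrite -[X in (X <= _)%N]muln1 leq_mul // expn_gt0 w_gt0.
Qed.

Let n_ge2 : (2 <= n)%N.
Proof. by apply: leq_trans le4w4; rewrite -[X in (X <= _)%N]muln1 leq_mul // expn_gt0 w_gt0. Qed.

Definition many_cycles := [set s in G | (16 * w ^ 2 < #|porbits s|)%N].

Lemma card_Alt_many_cycles : (#|many_cycles| * w ^ (14 * w ^ 2) <= #|G|)%N.
Proof.
have le_bad : (#|many_cycles| * w ^ (16 * w ^ 2) <= 2 * #|G| * w ^ (7 * w))%N.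
  rewrite card_Alt //; apply: leq_trans (_ : n`! * n.+1 ^ w <= _)%N; last first.
    by rewrite leq_mul2l expnM leq_exp2rW ?orbT.
  apply: leq_trans (card_many_cycles T (16 * w ^ 2) w_gt0).
  rewrite leq_mul2r; apply/orP; right; apply/subset_leq_card/subsetP=> s.
  by rewrite !inE => /andP[].
have w2 : (2 * w ^ (7 * w) <= w ^ (2 * w ^ 2))%N.
  apply: leq_trans (w_pow_le cubic_le lt_seventh (_ : (7 * w).+1 <= _)%N).
    by rewrite expnS leq_mul2r (leq_trans _ w_ge9) ?orbT.
  by move: w_ge9; rewrite -!mulnn; nia.
rewrite -(leq_pmul2r (_ : 0 < w ^ (2 * w ^ 2))%N) ?expn_gt0 ?w_gt0 //.
rewrite -mulnA -expnD -mulnDl; apply: leq_trans le_bad _.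
by rewrite (mulnC 2%N) -mulnA leq_mul2l w2 orbT.
Qed.

Section NormalSet.
Variable A : {set {perm T}}.
Hypothesis nAG : A <| G.
Hypothesis denseA : (#|G| <= w ^ (w ^ 2) * #|A|)%N.

Let sAG : A \subset G := normal_sub nAG.

Definition abs_sum i := `|\sum_(a in A) 'chi_i a|.

Lemma many_cycles_small : (#|many_cycles| * w ^ (13 * w ^ 2) <= #|A|)%N.
Proof.
rewrite -(leq_pmul2l (_ : 0 < w ^ (w ^ 2))%N) ?expn_gt0 ?w_gt0 //.
apply: leq_trans denseA; apply: leq_trans card_Alt_many_cycles.
by rewrite mulnCA -expnD -{1}[(w ^ 2)%N]mul1n -mulnDl.
Qed.

(** The ratio bound applies to the elements of A with few cycles; the trivial
    bound by the degree is used for the others. *)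
Lemma abs_sum_ratio i M : (0 < level i)%N -> (4 * level i <= n)%N ->
    (level i <= M)%N -> (16 * w ^ 2 <= M)%N ->
  abs_sum i * n%:R ^+ level i <=
    'chi_i 1%g * ((32 * M)%:R ^+ level i * #|A|%:R + n%:R ^+ level i * #|many_cycles|%:R).
Proof.
move=> l0 l4 lM wM; have [S [cS nzS minS]] := levelP i.
have X0 := irr1_gt0 i.
apply: (@le_trans _ _ (\sum_(a in A) `|'chi_i a| * n%:R ^+ level i)).
  by rewrite -mulr_suml ler_wpM2r ?exprn_ge0 ?ler0n // ler_norm_sum.
rewrite (bigID (mem many_cycles)) /= mulrDr addrC lerD //.
  rewrite mulrA mulr_natr -[_ *+ #|A|]sumr_const big_mkcondr /=; apply: ler_sum => s As.
  case: ifP => [good|_]; last by rewrite mulr_ge0 ?exprn_ge0 ?ler0n ?ltW.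
  rewrite -cS; apply: (irr_ratio_bound (S := S)); rewrite ?cS ?(subsetP sAG) //.
    apply: leq_trans wM; rewrite leqNgt; move: good; rewrite inE (subsetP sAG s As) /=.
    by case: (_ < _)%N.
  by move=> x Sx; apply: minS; rewrite -cS (cardsD1 x S) Sx.
rewrite [n%:R ^+ _ * _]mulrC mulrA [_ * #|many_cycles|%:R]mulr_natr -[_ *+ #|many_cycles|]sumr_const mulr_suml.
rewrite (eq_bigl (fun s => (s \in many_cycles) && (s \in A))) => [|s]; last by rewrite andbC.
rewrite big_mkcondr /=; apply: ler_sum => s _.
have n0 : 0 <= n%:R ^+ level i :> algC by rewrite exprn_ge0 ?ler0n.
case: ifP => _; last by rewrite mulr_ge0 // ltW.
by rewrite ler_wpM2r // char1_ge_norm ?irr_char.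
Qed.

Lemma abs_sum_low i : (0 < level i <= w ^ 2)%N ->
  abs_sum i * n%:R ^+ level i <=
    2 * 'chi_i 1%g * #|A|%:R * (2 ^ 9 * w ^ 2)%:R ^+ level i.
Proof.
case/andP=> l0 lw.
have w24 : (w ^ 2 <= w ^ 4)%N by rewrite leq_pexp2l.
have le1 : (4 * level i <= n)%N.
  by apply: leq_trans le4w4; rewrite leq_mul2l /= (leq_trans lw).
have le2 : (level i <= 16 * w ^ 2)%N by apply: leq_trans lw _; rewrite leq_pmull.
apply: le_trans (abs_sum_ratio l0 le1 le2 (leqnn _)) _.
rewrite (_ : 32 * (16 * w ^ 2) = 2 ^ 9 * w ^ 2)%N; last by rewrite mulnA.
have le3 : (n ^ level i * #|many_cycles| <= #|A|)%N.
  apply: leq_trans many_cycles_small; rewrite mulnC leq_mul2l; apply/orP; right.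
  apply: leq_trans (exp_level_le cubic_le lt_seventh lw) _.
  by rewrite (w_pow_le cubic_le lt_seventh) // leq_mul2r orbT.
set u := (2 ^ 9 * w ^ 2)%N.
have u1 : (1 <= u ^ level i)%N by rewrite expn_gt0 muln_gt0 !expn_gt0 w_gt0.
rewrite [2 * _]mulrC -!(@mulrA algC) ler_pM2l ?irr1_gt0 // -!natrX -!natrM -natrD ler_nat.
by nia.
Qed.

(** Between w ^ 2 and w ^ 4 this is the ratio bound with M = w ^ 4. Above w ^ 4 the
    degree exceeds w ^ (3 * w ^ 2), while Parseval bounds the sum over A by
    w ^ (w ^ 2) * |A|. *)
Lemma abs_sum_high i : (w ^ 2 < level i)%N ->
  abs_sum i * (w ^ (2 * w ^ 2))%:R <= 2 * 'chi_i 1%g * #|A|%:R.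
Proof.
move=> lw; have X0 := irr1_gt0 i.
have [l4|l4] := leqP (level i) (w ^ 4).
  have l0 : (0 < level i)%N by apply: leq_trans lw.
  have le1 : (4 * level i <= n)%N by apply: leq_trans le4w4; rewrite leq_mul2l.
  have le2 : (16 * w ^ 2 <= w ^ 4)%N.
    rewrite (expnD w 2 2) leq_mul2r; apply/orP; right.
    by apply: leq_trans w_ge9 _; rewrite -mulnn leq_pmulr.
  have := abs_sum_ratio l0 le1 l4 le2.
  set d := level i in lw l4 l0 *; set b := #|many_cycles| => le_d.
  have le3 : ((32 * w ^ 4) ^ d * w ^ (2 * w ^ 2) <= n ^ d)%N.
    apply: leq_trans (leq_exp2rW d (sixth_le cubic_le)).
    rewrite (expnD w 4 2) mulnA [X in (_ <= X)%N]expnMn leq_mul2l -expnM; apply/orP; right.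
    by rewrite (w_pow_le cubic_le lt_seventh) // leq_mul2l ltnW.
  have le4 : (b * w ^ (2 * w ^ 2) <= #|A|)%N.
    apply: leq_trans many_cycles_small; rewrite leq_mul2l (w_pow_le cubic_le lt_seventh) ?orbT //.
    by rewrite leq_mul2r orbT.
  have nd0 : 0 < n%:R ^+ d :> algC by rewrite exprn_gt0 // ltr0n (leq_trans _ n_ge2).
  rewrite -(ler_pM2r nd0) mulrAC.
  apply: (@le_trans _ _ ('chi_i 1%g * ((32 * w ^ 4)%:R ^+ d * #|A|%:R + n%:R ^+ d * b%:R)
              * (w ^ (2 * w ^ 2))%:R)); first by rewrite ler_wpM2r ?ler0n.
  rewrite [2 * _]mulrC -!(@mulrA algC) ler_pM2l // -!natrX -!natrM -natrD -natrM ler_nat.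
  by nia.
have le_deg : (w ^ (3 * w ^ 2))%:R <= 'chi_i 1%g.
  apply: (@le_trans _ _ (2 ^ (3 * w ^ 3))%:R).
    rewrite ler_nat; apply: leq_trans (leq_exp2rW _ (ltnW (ltn_expl w (isT : 1 < 2)%N))) _.
    by rewrite -expnM mulnCA -expnS.
  have le9 : (3 * (3 * w ^ 3) + 2 <= w ^ 4)%N.
    by rewrite [(w ^ 4)%N]expnS; have : (1 <= w ^ 3)%N; [rewrite expn_gt0 w_gt0 | move: w_ge9; nia].
  apply: degree_level_ge; first by move: le9 l4; lia.
  by apply: leq_trans le4w4; move: le9; lia.
have le_a : abs_sum i <= (w ^ (w ^ 2))%:R * #|A|%:R.
  have E0 : 0 <= (w ^ (w ^ 2))%:R * #|A|%:R :> algC by rewrite mulr_ge0 ?ler0n.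
  rewrite -(ler_pXn2r (isT : (0 < 2)%N)) ?nnegrE // ?normr_ge0 //.
  apply: (@le_trans _ _ (#|G|%:R * #|A|%:R)).
    rewrite -(sum_irr_normal_sum_norm nAG) (bigD1 i) //= lerDl.
    by apply: sumr_ge0 => j _; rewrite exprn_ge0.
  rewrite -natrM -natrM -natrX ler_nat -mulnn mulnA leq_mul2r; apply/orP; right.
  by apply: leq_trans denseA _; rewrite leq_pmulr // expn_gt0 w_gt0.
apply: (@le_trans _ _ ((w ^ (3 * w ^ 2))%:R * #|A|%:R)).
  apply: le_trans (ler_wpM2r _ le_a) _; first exact: ler0n.
  by rewrite -!natrM ler_nat mulnAC -expnD -mulSn.
by rewrite ler_wpM2r ?ler0n // (le_trans le_deg) // mulr_natl mulr2n lerDl ltW.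
Qed.
End NormalSet.

Lemma ge0_double_mul (x y : algC) : 0 <= x -> 0 <= y -> 2 * (x * y) <= x ^+ 2 + y ^+ 2.
Proof.
move=> x0 y0; rewrite -subr_ge0.
have -> : x ^+ 2 + y ^+ 2 - 2 * (x * y) = (x - y) ^+ 2 by ring.
by apply: real_exprn_even_ge0 => //; apply: realB; apply: ger0_real.
Qed.

Lemma sum_geometric_half D : \sum_(d < D) (2 ^+ d)^-1 <= 2 :> algC.
Proof.
suff -> : \sum_(d < D) (2 ^+ d)^-1 = 2 - 2 * (2 ^+ D)^-1 :> algC.
  by rewrite lerBlDr lerDl mulr_ge0 ?ler0n // invr_ge0 exprn_ge0 ?ler0n.
elim: D => [|D IHD]; first by rewrite big_ord0 expr0 invr1 mulr1 subrr.
rewrite big_ord_recr /= IHD exprS; field.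
by rewrite expf_neq0 ?pnatr_eq0.
Qed.

Section ThreeSets.
Variables A B C : {set {perm T}}.
Hypotheses (nA : A <| G) (nB : B <| G) (nC : C <| G).
Hypothesis denseA : (#|G| <= w ^ (w ^ 2) * #|A|)%N.
Hypothesis denseB : (#|G| <= w ^ (w ^ 2) * #|B|)%N.
Hypothesis denseC : (#|G| <= w ^ (w ^ 2) * #|C|)%N.

Let P : algC := (#|A| * #|B| * #|C|)%:R.
Let term i := abs_sum A i * abs_sum B i * abs_sum C i / 'chi_i 1%g.

Let term_ge0 i : 0 <= term i.
Proof. by rewrite /term /abs_sum mulr_ge0 ?invr_ge0 ?(ltW (irr1_gt0 i)) // !mulr_ge0. Qed.

Let dense_gt0 (D : {set {perm T}}) : (#|G| <= w ^ (w ^ 2) * #|D|)%N -> (0 < #|D|)%N.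
Proof.
case: #|D| => //; rewrite muln0 leqn0 => /eqP G0.
by have := cardG_gt0 G; rewrite G0.
Qed.

(** With u = 32 * (16 * w ^ 2), the three ratio bounds and the sum of degrees give
    8 * P * (u ^ 3 / n) ^ d, and u ^ 3 / n <= 2 ^ -13. *)
Lemma level_sum_low d : (0 < d <= w ^ 2)%N ->
  \sum_(i | level i == d) term i <= P / 512 * (2 ^+ d)^-1.
Proof.
move=> /[dup] d_lim /andP[d0 dw].
set u := (2 ^ 9 * w ^ 2)%N.
have nd0 : 0 < n%:R ^+ d :> algC by rewrite exprn_gt0 // ltr0n (leq_trans _ n_ge2).
have le_n : (2 ^ (13 * d) * u ^ (3 * d) <= n ^ d)%N.
  by rewrite !expnM -expnMn leq_exp2rW.
have le1 : \sum_(i | level i == d) term i * (n%:R ^+ d * n%:R ^+ d * n%:R ^+ d) <=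
    8 * P * (u%:R ^+ d * u%:R ^+ d * u%:R ^+ d) * (n%:R ^+ d * n%:R ^+ d).
  apply: (@le_trans _ _ (\sum_(i | level i == d)
      8 * P * (u%:R ^+ d * u%:R ^+ d * u%:R ^+ d) * ('chi_i 1%g * 'chi_i 1%g))).
    apply: ler_sum => i /eqP li; have X0 := irr1_gt0 i.
    have lo (D : {set {perm T}}) : D <| G -> (#|G| <= w ^ (w ^ 2) * #|D|)%N ->
        abs_sum D i * n%:R ^+ d <= 2 * 'chi_i 1%g * #|D|%:R * u%:R ^+ d.
      by move=> nD dD; rewrite -li; apply: abs_sum_low => //; rewrite li.
    have lA := lo A nA denseA; have lB := lo B nB denseB; have lC := lo C nC denseC.
    have pos D : 0 <= abs_sum D i * n%:R ^+ d by rewrite mulr_ge0 ?normr_ge0 // ltW.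
    have := ler_pM (mulr_ge0 (pos A) (pos B)) (pos C) (ler_pM (pos A) (pos B) lA lB) lC.
    move=> le3; rewrite -(ler_pM2r X0).
    apply: le_trans (le_trans le3 _); rewrite le_eqVlt; apply/orP; left; apply/eqP.
      by rewrite /term; field; rewrite lt0r_neq0.
    by rewrite /P !natrM; ring.
  rewrite -mulr_sumr ler_wpM2l //.
    by rewrite !mulr_ge0 ?exprn_ge0 ?ler0n.
  have d2 : (d + 2 <= n)%N.
    apply: leq_trans le4w4; apply: (@leq_trans (w ^ 2 + 2)); first by rewrite leq_add2r.
    by have : (1 <= w ^ 2)%N; [rewrite expn_gt0 w_gt0 | rewrite (expnD w 2 2); move: (w ^ 2)%N => p; nia].
  have := sum_degree_level d2; set s := \sum_(i | _) _ => le_s.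
  have s0 : 0 <= s by apply: sumr_ge0 => i _; rewrite ltW ?irr1_gt0.
  apply: (@le_trans _ _ (s * s)).
    rewrite /s mulr_suml; apply: ler_sum => i li; rewrite ler_wpM2l ?(ltW (irr1_gt0 i)) //.
    rewrite (bigD1 i) //= lerDl; apply: sumr_ge0 => j _; exact: ltW (irr1_gt0 j).
  by rewrite -natrX ler_pM.
rewrite -mulr_suml in le1.
have le2 : (\sum_(i | level i == d) term i) * n%:R ^+ d <= 8 * P * u%:R ^+ (3 * d).
  rewrite -(ler_pM2r (mulr_gt0 nd0 nd0)); apply: le_trans (le_trans le1 _).
    by rewrite -!mulrA.
  by rewrite mulSn mulSn mul1n !exprD !mulrA.
have t13 : 0 < (2 ^ (13 * d))%:R :> algC by rewrite ltr0n expn_gt0.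
have P0 : 0 <= P by apply: ler0n.
have un0 : 0 < (u ^ (3 * d))%:R :> algC by rewrite ltr0n expn_gt0 muln_gt0 !expn_gt0 w_gt0.
have le4 : (\sum_(i | level i == d) term i) * (2 ^ (13 * d))%:R <= 8 * P.
  rewrite -(ler_pM2r un0) -mulrA -natrM [X in _ <= _ * X]natrX; apply: le_trans le2.
  rewrite ler_wpM2l ?sumr_ge0 // -natrX ler_nat //.
rewrite -(ler_pM2r t13); apply: le_trans le4 _.
rewrite -[X in _ <= X]mulrA -mulrA [8 * _]mulrC ler_wpM2l // ler_pdivlMl ?ltr0n // ler_pdivlMl ?exprn_gt0 ?ltr0n //.
rewrite -natrX -!natrM ler_nat (_ : 2 ^ d * (512 * 8) = 2 ^ (d + 12))%N; last by rewrite expnD.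
by rewrite leq_exp2l //; lia.
Qed.

(** Cauchy-Schwarz and Parseval for B and C. *)
Lemma sum_abs_sum_mul : \sum_i abs_sum B i * abs_sum C i <= (w ^ (w ^ 2) * #|B| * #|C|)%:R.
Proof.
have B0 := dense_gt0 denseB; have C0 := dense_gt0 denseC.
have BC0 : 0 < (2 * (#|B| * #|C|))%:R :> algC by rewrite ltr0n !muln_gt0 B0.
rewrite -(ler_pM2l BC0) mulr_sumr.
apply: (@le_trans _ _ (\sum_i (#|C|%:R ^+ 2 * abs_sum B i ^+ 2 + #|B|%:R ^+ 2 * abs_sum C i ^+ 2))).
  apply: ler_sum => i _; rewrite -!exprMn.
  apply: le_trans (ge0_double_mul _ _); rewrite ?mulr_ge0 ?ler0n ?normr_ge0 //.
  by rewrite !natrM le_eqVlt; apply/orP; left; apply/eqP; ring.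
rewrite big_split -!mulr_sumr /= !sum_irr_normal_sum_norm // -!natrX -!natrM -natrD ler_nat.
move: (leq_mul (leqnn (#|C| * #|C| * #|B|)) denseB) (leq_mul (leqnn (#|B| * #|B| * #|C|)) denseC).
by move: (w ^ _)%N #|B| #|C| #|G| => E b c g; rewrite -!mulnn; nia.
Qed.

Lemma sum_high : \sum_(i | (w ^ 2 < level i)%N) term i <= P / 1024.
Proof.
have W0 : 0 < (w ^ (2 * w ^ 2))%:R :> algC by rewrite ltr0n expn_gt0 w_gt0.
rewrite -(ler_pM2r W0) mulr_suml.
apply: (@le_trans _ _ (\sum_i 2 * #|A|%:R * (abs_sum B i * abs_sum C i))).
  rewrite big_mkcond /=; apply: ler_sum => i _; have X0 := irr1_gt0 i.
  case: ifP => [lw|_]; last by rewrite !mulr_ge0 ?ler0n ?normr_ge0.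
  rewrite /term mulrAC ler_pdivrMr //.
  have := abs_sum_high nA denseA lw => /(ler_wpM2r (mulr_ge0 (normr_ge0 (\sum_(a in B) 'chi_i a)) (normr_ge0 (\sum_(a in C) 'chi_i a)))).
  rewrite -!/(abs_sum _ _); congr (_ <= _); ring.
rewrite -mulr_sumr.
apply: le_trans (ler_wpM2l _ sum_abs_sum_mul) _; first by rewrite mulr_ge0 ?ler0n.
have le2 : (2 * 1024 <= w ^ (w ^ 2))%N.
  apply: (@leq_trans (w ^ 2)); last first.
    by rewrite (w_pow_le cubic_le lt_seventh) // (leq_trans _ (leq_exp2rW 2 w_ge9)).
  apply: leq_trans (leq_exp2rW 2 (ltnW (w_large cubic_le lt_seventh))).
  by rewrite -expnM (@leq_exp2l 2 11 20).
rewrite [X in _ <= X]mulrAC ler_pdivlMr ?ltr0n // -!natrM ler_nat [(2 * w ^ 2)%N]mul2n -addnn expnD.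
move: (w ^ (w ^ 2))%N le2 => E le2.
have := leq_mul (leqnn (#|A| * #|B| * #|C| * E)) le2.
by move: #|A| #|B| #|C| => a b c; nia.
Qed.

Lemma product_count_error :
  `|#|G|%:R * (product_count A B C)%:R - P| <= P / 200.
Proof.
have P0 : 0 <= P by apply: ler0n.
rewrite product_count_irr // (bigD1 (0 : Iirr G)) //= irr0.
have sum1 (D : {set {perm T}}) : D <| G -> \sum_(a in D) (1 : 'CF(G)) a = #|D|%:R.
  move=> nD; rewrite -sumr_const; apply: eq_bigr => a Da.
  by rewrite cfun1E (subsetP (normal_sub nD)).
rewrite !sum1 // cfun1E group1 divr1 conjC_nat -!natrM -/P addrAC subrr add0r.
apply: (@le_trans _ _ (\sum_(i | i != 0) term i)).
  apply: le_trans (ler_norm_sum _ _ _) _; apply: ler_sum => i _.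
  by rewrite !normrM normfV norm_conjC (ger0_norm (ltW (irr1_gt0 i))).
have lev_gt0 i : i != 0 -> (0 < level i)%N.
  by rewrite lt0n; apply: contra => /eqP/(level0 n_ge2) ->.
apply: (@le_trans _ _ (\sum_(d < (w ^ 2).+1) P / 512 * (2 ^+ d)^-1 + P / 1024)).
  rewrite (bigID (fun i => (level i <= w ^ 2)%N)) /= lerD //; last first.
    apply: le_trans sum_high; rewrite big_mkcond [X in _ <= X]big_mkcond /=.
    by apply: ler_sum => i _; rewrite ltnNge; case: (_ <= _)%N; case: (i != 0) => //=; apply: term_ge0.
  rewrite (partition_big (fun i => inord (level i) : 'I_(w ^ 2).+1) xpredT) //=.
  apply: ler_sum => d _; have [d0|d0] := posnP d.
    rewrite big_pred0 => [|i].
      by rewrite mulr_ge0 ?(mulr_ge0 P0) ?invr_ge0 ?exprn_ge0 ?ler0n.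
    apply/negP=> /andP[/andP[/lev_gt0 l0 lw] /eqP ld].
    by move: l0; rewrite -(inordK (lw : (level i < (w ^ 2).+1)%N)) ld d0.
  apply: le_trans (level_sum_low _); last by rewrite d0 -ltnS ltn_ord.
  rewrite big_mkcond [X in _ <= X]big_mkcond /=; apply: ler_sum => i _.
  case: ifP => [/andP[/andP[_ lw] /eqP ld]|_]; last by case: ifP.
  by rewrite -ld inordK // eqxx.
rewrite -mulr_sumr.
apply: (@le_trans _ _ (P / 512 * 2 + P / 1024)).
  by rewrite lerD2r ler_wpM2l ?mulr_ge0 ?invr_ge0 ?ler0n // sum_geometric_half.
have -> : P / 512 * 2 + P / 1024 = P * (5 / 1024) by field.
rewrite ler_wpM2l // ler_pdivrMr ?ltr0n // mulrC ler_pdivlMr ?ltr0n //.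
by rewrite -!natrM ler_nat.
Qed.
End ThreeSets.
End Mixing.

(** * The threshold density *)

Lemma nat_error_bounds (g N P : nat) :
    `|g%:R * N%:R - P%:R| <= P%:R / 200 :> algC ->
  (199 * P <= 200 * (g * N))%N /\ (200 * (g * N) <= 201 * P)%N.
Proof.
rewrite ler_pdivlMr ?ltr0n // -natrM => le1.
move: le1; rewrite -[200](normr_nat algC 200) -normrM mulrBl -!natrM.
rewrite real_ler_norml ?realB ?realn // => /andP[].
rewrite lerNl opprB !lerBlDr -!natrD !ler_nat.
by move: (g * N)%N => M; lia.
Qed.

Section Reals.
Variable R : realType.

Definition threshold (c : R) n : R := n%:R `^ (- (c * n%:R `^ (3%:R)^-1)).

Lemma exists_sixth_root (K n : nat) : (0 < K)%N ->
  exists w, (K * w ^ 6 <= n < K * w.+1 ^ 6)%N.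
Proof.
move=> K0; have ex0 : exists w, (K * w ^ 6 <= n)%N by exists 0%N; rewrite muln0.
have bnd w : (K * w ^ 6 <= n)%N -> (w <= n)%N.
  apply: leq_trans; apply: (@leq_trans (w ^ 6)); last by rewrite leq_pmull.
  by case: w => // v; rewrite -{1}(expn1 v.+1) leq_pexp2l.
case: (ex_maxnP ex0 bnd) => w le_w max_w; exists w; rewrite le_w ltnNge.
by apply/negP=> /max_w; rewrite ltnn.
Qed.

Lemma root_large (K L n w : nat) : (K * L ^ 6 <= n)%N -> (n < K * w.+1 ^ 6)%N -> (L <= w)%N.
Proof.
move=> le_n lt_n; rewrite leqNgt; apply/negP=> ltwL.
have := leq_trans lt_n (leq_trans (leq_mul (leqnn K) (leq_exp2rW 6 ltwL)) le_n).
by rewrite ltnn.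
Qed.

Lemma succ_sixth_le (K w : nat) : (0 < w)%N -> (K * w.+1 ^ 6 <= K * 2 ^ 6 * w ^ 6)%N.
Proof.
move=> w0; rewrite -mulnA -expnMn leq_mul2l leq_exp2rW ?orbT //.
by rewrite mul2n -addnn -addn1 leq_add2l.
Qed.

Lemma density_le (gT : finGroupType) (G : {group gT}) (A : {set gT}) (E : nat) (e : R) :
  E%:R^-1 <= e -> (0 < E)%N -> e <= density R G A -> (#|G| <= E * #|A|)%N.
Proof.
move=> le_e E0 /(le_trans le_e); rewrite /density ler_pdivlMr ?ltr0n ?cardG_gt0 //.
by rewrite ler_pdivrMl ?ltr0n // -natrM ler_nat.
Qed.

(** Here n ^ (1/3) is at most 2 ^ 16 * w ^ 2, so the exponent of n is at most
    w ^ 2 / 7, and n < w ^ 7. *)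
Lemma threshold_ge c n w : 0 < c -> c * (7 * 2 ^ 16)%:R <= 1 ->
    (n < w ^ 7)%N -> (n <= 2 ^ 46 * w ^ 6)%N -> (0 < n)%N ->
  (w ^ (w ^ 2))%:R^-1 <= threshold c n.
Proof.
move=> c0 c1 n7 n6 n0.
have w0 : (0 < w)%N by case: w n7 {n6} => //.
have root_le : n%:R `^ (3%:R)^-1 <= (2 ^ 16 * w ^ 2)%:R :> R.
  have -> : (2 ^ 16 * w ^ 2)%:R = ((2 ^ 16 * w ^ 2)%:R ^+ 3) `^ (3%:R)^-1 :> R.
    by rewrite -powR_mulrn ?ler0n // -powRrM mulfV ?pnatr_eq0 // powRr1 ?ler0n.
  rewrite ge0_ler_powR ?nnegrE ?invr_ge0 ?exprn_ge0 ?ler0n // -natrX ler_nat.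
  apply: leq_trans n6 _; rewrite expnMn -!expnM leq_mul2r; apply/orP; right.
  by rewrite leq_exp2l.
have n1 : 1 <= n%:R :> R by rewrite ler1n.
rewrite /threshold powRN lef_pV2 ?posrE ?powR_gt0 ?ltr0n ?expn_gt0 ?w0 //.
apply: (@le_trans _ _ (n%:R `^ ((w ^ 2)%:R / 7))).
  apply: ler_powR => //; apply: le_trans (ler_wpM2l (ltW c0) root_le) _.
  rewrite ler_pdivlMr ?ltr0n // -[X in _ <= X]mul1r natrM.
  rewrite (_ : _ * _ * 7 = c * (7 * 2 ^ 16)%:R * (w ^ 2)%:R); last by rewrite natrM; ring.
  by rewrite ler_wpM2r ?ler0n.
apply: (@le_trans _ _ (((w ^ 7)%:R : R) `^ ((w ^ 2)%:R / 7))).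
  by rewrite ge0_ler_powR ?nnegrE ?mulr_ge0 ?invr_ge0 ?ler0n // ler_nat ltnW.
rewrite natrX -powR_mulrn ?ler0n // -powRrM mulrC divfK ?pnatr_eq0 // powR_mulrn ?ler0n //.
by rewrite natrX.
Qed.

Lemma one_percent (x y : R) : 0 <= x -> 200 * y <= 201 * x -> 199 * x <= 200 * y ->
  x / (101 / 100) <= y /\ y <= 101 / 100 * x.
Proof. by move=> x0 hi lo; split; lra. Qed.

(** The parameter w is the integer part of (n / 2 ^ 40) ^ (1/6); n < w ^ 7 holds
    because w is at least L. *)
Lemma mixer_large c n (K L : nat) : K = (2 ^ 40)%N -> L = (K * 2 ^ 6)%N ->
    0 < c -> c * (7 * 2 ^ 16)%:R <= 1 -> (K * L ^ 6 <= n)%N ->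
  normally_mixer ('Alt_('I_n))%G (threshold c n).
Proof.
move=> KE LE c0 c1 n_large.
have K0 : (0 < K)%N by rewrite KE expn_gt0.
have [w /andP[le_w lt_w]] := exists_sixth_root n K0.
have wL : (L <= w)%N := root_large n_large lt_w.
have w0 : (0 < w)%N by apply: leq_trans wL; rewrite LE muln_gt0 K0 expn_gt0.
have n6 : (n <= L * w ^ 6)%N by rewrite LE; apply: leq_trans (ltnW lt_w) (succ_sixth_le K w0).
have LE' : L = (2 ^ 46)%N by rewrite LE KE -expnD; congr (2 ^ _)%N.
have lt7 : (n < w ^ 7)%N.
  apply: leq_trans lt_w _; rewrite expnS; apply: leq_trans (leq_mul wL (leqnn (w ^ 6))).
  by rewrite LE succ_sixth_le.
have cubic : (2 ^ 13 * (2 ^ 9 * w ^ 2) ^ 3 <= #|'I_n|)%N.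
  rewrite card_ord expnMn -!expnM mulnA -expnD.
  by move: le_w; rewrite KE; congr (2 ^ _ * _ <= _)%N.
have n0 : (0 < n)%N by apply: leq_trans le_w; rewrite muln_gt0 K0 expn_gt0 w0.
rewrite LE' in n6; have le_th := threshold_ge c0 c1 lt7 n6 n0.
have E0 : (0 < w ^ (w ^ 2))%N by rewrite expn_gt0 w0.
move=> A B C nA nB nC /(density_le le_th E0) dA /(density_le le_th E0) dB /(density_le le_th E0) dC.
have lt7' : (#|'I_n| < w ^ 7)%N by rewrite card_ord.
have := product_count_error cubic lt7' nA nB nC dA dB dC.
move=> /nat_error_bounds[lo hi] p.
have pE : p = (product_count A B C)%:R / (#|A| * #|B|)%:R by rewrite /p /uniform_pr cardsX.
have pos (D : {set {perm 'I_n}}) : (#|'Alt_('I_n)| <= w ^ (w ^ 2) * #|D|)%N -> 0 < #|D|%:R :> R.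
  by case: #|D| => [|k]; rewrite ?ltr0n // muln0 leqn0 => /eqP g0; have := cardG_gt0 'Alt_('I_n); rewrite g0.
have a0 := pos A dA; have b0 := pos B dB; have g0 : 0 < #|'Alt_('I_n)|%:R :> R by rewrite ltr0n cardG_gt0.
rewrite -(ler_nat R) in lo; rewrite -(ler_nat R) in hi.
move: lo hi; rewrite !natrM /density pE natrM.
move: a0 b0 g0; set a : R := #|A|%:R; set b : R := #|B|%:R; set d : R := #|C|%:R.
set g : R := #|'Alt_('I_n)|%:R; set N : R := (product_count A B C)%:R => a0 b0 g0 lo hi.
have d0 : 0 <= d by apply: ler0n.
clearbody a b d g N.
have ab0 : 0 < a * b by rewrite mulr_gt0.
have X0 : 0 < a * b * g by rewrite mulr_gt0.
have nz : (a != 0) && (b != 0) && (g != 0) by rewrite !lt0r_neq0.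
have {nz} /andP[/andP[a_nz b_nz] g_nz] := nz.
have Np : N / (a * b) * (a * b * g) = g * N by field; rewrite ?a_nz ?b_nz.
have dg : d / g * (a * b * g) = a * b * d by field.
have {lo} : 199 * (d / g) <= 200 * (N / (a * b)).
  by rewrite -(ler_pM2r X0) -(mulrA 199) dg -(mulrA 200) Np.
have {hi} : 200 * (N / (a * b)) <= 201 * (d / g).
  by rewrite -(ler_pM2r X0) -(mulrA 201) dg -(mulrA 200) Np.
have : 0 <= d / g by rewrite divr_ge0 // ltW.
by move=> x0 hi lo; apply: one_percent.
Qed.

Lemma mixer_full (gT : finGroupType) (G : {group gT}) (e : R) :
  1 - #|G|%:R^-1 < e -> normally_mixer G e.
Proof.
move=> e1 A B C nA nB nC.
have G0 : 0 < #|G|%:R :> R by rewrite ltr0n cardG_gt0.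
have full (D : {set gT}) : (D <| G)%g -> e <= density R G D -> D = G.
  move=> nD /(lt_le_trans e1); rewrite /density ltr_pdivlMr // mulrBl mul1r mulVf ?lt0r_neq0 //.
  rewrite ltrBlDr -(natrD _ _ 1) ltr_nat addn1 ltnS => le.
  by apply/eqP; rewrite eqEcard normal_sub.
move=> /(full A nA)-> /(full B nB)-> /(full C nC)-> p.
have -> : p = 1.
  rewrite /p /uniform_pr; set S := [set _ in _ | _]; have -> : S = setX G G.
    by apply/setP=> -[x y]; rewrite !inE /=; apply: andb_idr => /andP[Gx Gy]; rewrite groupM.
  by rewrite divff // cardsX pnatr_eq0 -lt0n muln_gt0 !cardG_gt0.
by rewrite /density divff ?lt0r_neq0 //; split; lra.
Qed.

Lemma mixer_small c n N : 0 < c -> c * (N`! * N ^ 2)%:R < 1 -> (n <= N)%N ->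
  normally_mixer ('Alt_('I_n))%G (threshold c n).
Proof.
move=> c0 cN nN; apply: mixer_full.
have G0 : 0 < #|'Alt_('I_n)|%:R :> R by rewrite ltr0n cardG_gt0.
have [->|n0] := posnP n.
  have root0 : (0%:R : R) `^ (3%:R)^-1 = 0 by rewrite powR0 // invr_eq0 pnatr_eq0.
  rewrite /threshold root0 mulr0 oppr0 powRr0.
  by rewrite ltrBlDr ltrDl invr_gt0 ltr0n cardG_gt0.
have n1 : 1 <= n%:R :> R by rewrite ler1n.
have npos : 0 < n%:R :> R by rewrite ltr0n.
have root_le : n%:R `^ (3%:R)^-1 <= n%:R :> R.
  rewrite -[X in _ <= X]powRr1 ?ler0n //; apply: ler_powR => //.
  by rewrite invf_le1 ?ler1n ?ltr0n.
have ln_le : ln (n%:R : R) <= n%:R.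
  by apply/ltW/ln_sublinear.
have ln_ge : 0 <= ln (n%:R : R) by apply: ln_ge0.
apply: lt_le_trans (_ : 1 - c * (n%:R * n%:R) <= _); last first.
  have nn0 : n%:R != 0 :> R by rewrite lt0r_neq0.
  rewrite /threshold [X in _ <= X]/powR (negPf nn0).
  apply: le_trans (expR_ge1Dx _); rewrite lerD2l mulNr lerN2 -mulrA ler_pM2l //.
  by rewrite ler_pM ?powR_ge0.
rewrite ltrD2l ltrN2 -[_^-1]mul1r ltr_pdivlMr //.
apply: le_lt_trans cN; rewrite -mulrA ler_pM2l // -!natrM ler_nat mulnC leq_mul //.
  apply: leq_trans (subset_leq_card (Alt_subset 'I_n)) _.
  by rewrite card_Sym card_ord leq_fact.
by rewrite -mulnn leq_mul.
Qed.

End Reals.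

Theorem theorem2p6 (R : realType) :
  exists c : R, 0 < c /\
    forall n : nat,
      normally_mixer ('Alt_('I_n))%G (n%:R `^ (- (c * n%:R `^ (3%:R)^-1))).
Proof.
(* Known by equations only: unary numerals of this size must not be evaluated. *)
have [K KE] : exists K, K = (2 ^ 40)%N by eexists.
have [L LE] : exists L, L = (K * 2 ^ 6)%N by eexists.
have [N NE] : exists N, N = (K * L ^ 6)%N by eexists.
have [D [D1 D2]] : exists D, (7 * 2 ^ 16 <= D)%N /\ (N`! * N ^ 2 < D)%N.
  by exists (7 * 2 ^ 16 + N`! * N ^ 2).+1; split; [apply/leqW/leq_addr | rewrite ltnS leq_addl].
have D0 : 0 < D%:R :> R by rewrite ltr0n (leq_ltn_trans _ D2).
have Dinv : 0 < D%:R^-1 :> R by rewrite invr_gt0.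
exists D%:R^-1; split=> // n.
have [nN|Nn] := leqP n N.
  by apply: (mixer_small Dinv _ nN); rewrite mulrC ltr_pdivrMr // mul1r ltr_nat.
apply: (mixer_large KE LE Dinv); last by rewrite -NE ltnW.
by rewrite mulrC ler_pdivrMr // mul1r ler_nat.
Qed.
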